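(* Let $X$ be a regular diffusion on an interval $I\subset\mathbb{R}$ whose associated differential operator is $$\mathcal{G}u(x)=\tfrac12 a^2(x)u''(x)+b(x)u'(x),\qquad x\in I,$$ where $x\mapsto a^2(x)>0$ and $x\mapsto b(x)$ are continuous on $I$. Let $x_o\in\operatorname{Int}(I)$. Then $$\lim_{h\downarrow0}\frac{\mathbb{E}^X_{x_o}[\mathcal{T}_{(x_o-h,x_o+h)}]}{h^2}=a^{-2}(x_o),$$ where $a^{-2}(x_o)=1/a^2(x_o)$.
   Context: $X=(X_t)_{t\ge0}$ is a regular diffusion on $I$ in the sense of Itô and McKean; $\mathbb{E}^X_{x}$ denotes expectation under its law started from $x$. The first exit time is $\mathcal{T}_{(c,d)}:=\inf\{t>0:X_t\notin(c,d)\}$, with $\inf\emptyset=\infty$. The scale function $s$ and the speed measure $m^X$ of such a diffusion are $s'(x)=e^{-B(x)}$ and $m^X(dx)=2a^{-2}(x)e^{B(x)}dx$, where $B(x)=\int^x 2a^{-2}(y)b(y)\,dy$. *)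

(* Defs.v *)
From HB Require Import structures.
From mathcomp Require Import all_boot all_order all_algebra.
From mathcomp Require Import all_classical all_reals all_analysis.
From mathcomp Require Import measurable_realfun.
Set Implicit Arguments.
Unset Strict Implicit.
Unset Printing Implicit Defensive.
Import Order.TTheory GRing.Theory Num.Theory.
Import numFieldNormedType.Exports.
Local Open Scope classical_set_scope.
Local Open Scope ring_scope.

(* A process with state space I is a map X : R -> Omega -> option R.  Only
   the times t >= 0 are ever used.  As in Ito and McKean, the process may have
   a finite lifetime: X t w = None means that the path w is in the cemetery at
   time t. *)
Section diffusion.
Context (d : measure_display) (Omega : measurableType d) (R : realType).
Implicit Types (X : R -> Omega -> option R) (P : R -> probability Omega R).

Definition state_in X (t : R) (B : set R) : set Omega :=
  X t @^-1` (Some @` B).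

Definition natural_sigma X (J : set R) : set (set Omega) :=
  <<s [set A | exists (t : R) (B : set R),
    [/\ J t, measurable B & A = state_in X t B] ] >>.

Definition history X (t : R) : set (set Omega) :=
  natural_sigma X [set s : R | 0 <= s <= t].

(* Ito and McKean's Markov times: a strict inequality, so that these are the
   optional times. *)
Definition markov_time X (tau : Omega -> \bar R) : Prop :=
  (forall w, (0 <= tau w)%E) /\
  (forall t : R, 0 <= t -> history X t [set w | (tau w < t%:E)%E]).

(* The sigma-algebra "tau+".  No condition is put on A within {tau = +oo},
   because A is only used through its intersection with {tau < +oo}. *)
Definition history_plus X (tau : Omega -> \bar R) (A : set Omega) : Prop :=
  forall t : R, 0 <= t -> history X t (A `&` [set w | (tau w < t%:E)%E]).

(* The transition function P_y(X_t \in B), extended by 0 to the cemetery. *)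
Definition transition P X (t : R) (B : set R) (o : option R) : \bar R :=
  if o is Some y then P y (state_in X t B) else 0%E.

Definition strong_markov (I : set R) P X : Prop :=
  forall (x : R) (tau : Omega -> \bar R) (A : set Omega) (t : R) (B : set R),
    I x -> markov_time X tau -> history_plus X tau A -> 0 <= t ->
    measurable B ->
    P x (A `&` [set w | (tau w < +oo)%E /\
                        state_in X (fine (tau w) + t) B w]) =
    (\int[P x]_(w in A `&` [set w | (tau w < +oo)%E])
        transition P X t B (X (fine (tau w)) w))%E.

(* Regularity is required between interior points only, so that absorbing
   end-points and entrance end-points belonging to I are allowed. *)
Record regular_diffusion (I : set R) P X : Prop := RegularDiffusion {
  diffusion_interval : is_interval I ;
  diffusion_measurable : forall (t : R) (B : set R), 0 <= t -> measurable B ->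
    measurable (state_in X t B) ;
  diffusion_state : forall (t : R) w y, 0 <= t -> X t w = Some y -> I y ;
  diffusion_cemetery : forall (s t : R) w, 0 <= s -> s <= t ->
    X s w = None -> X t w = None ;
  diffusion_continuous : forall (t : R) w y, 0 <= t -> X t w = Some y ->
    forall e : R, 0 < e -> \forall s \near t,
      0 <= s -> exists2 z, X s w = Some z & `|z - y| < e ;
  diffusion_start : forall x : R, I x -> P x (state_in X 0 [set x]) = 1%E ;
  diffusion_measurable_law : forall A : set Omega,
    natural_sigma X [set t : R | 0 <= t] A ->
    measurable_fun I (fun x : R => P x A) ;
  diffusion_strong_markov : strong_markov I P X ;
  diffusion_regular : forall x y : R, interior I x -> interior I y ->
    (0 < P x [set w | exists2 t, (0 <= t)%R & X t w = Some y])%E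
}.

(* P_t f (x) = E_x[f(X_t)], with f = 0 at the cemetery. *)
Definition semigroup P X (t : R) (f : R -> R) (x : R) : R :=
  \int[P x]_w (if X t w is Some y then f y else 0).

Definition Cb (I : set R) (f : R -> R) : Prop :=
  {within I, continuous f} /\ exists M : R, forall x : R, I x -> `|f x| <= M.

(* f is in the domain of the infinitesimal generator on C_b(I), with image g:
   the difference quotients converge boundedly and pointwise on I. *)
Definition generator (I : set R) P X (f g : R -> R) : Prop :=
  [/\ Cb I f, Cb I g,
      (forall x : R, I x ->
         (semigroup P X t f x - f x) / t @[t --> 0^'+] --> g x) &
      exists M : R, forall t x : R, 0 < t -> I x ->
         `|(semigroup P X t f x - f x) / t| <= M].

Definition C2c (U : set R) (f : R -> R) : Prop :=
  [/\ (forall x : R, derivable f x 1),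
      (forall x : R, derivable (derive1 f) x 1),
      continuous (derive1n 2 f) &
      exists K : set R, [/\ compact K, K `<=` U & forall x, ~ K x -> f x = 0]].

Definition diff_op (a b : R -> R) (u : R -> R) (x : R) : R :=
  2^-1 * a x ^+ 2 * derive1n 2 u x + b x * derive1 u x.

(* The infinitesimal generator acts as diff_op a b on C^2 functions with
   compact support in the interior of I.  Such functions satisfy every boundary
   condition, so this does not depend on the behaviour at the end-points. *)
Definition associated_operator (I : set R) P X (a b : R -> R) : Prop :=
  forall u, C2c (interior I) u -> generator I P X u (diff_op a b u).

(* inf {t > 0 | X_t \notin (l, r)}; the cemetery is outside (l, r), and
   ereal_inf set0 = +oo. *)
Definition exit_time X (l r : R) (w : Omega) : \bar R :=
  ereal_inf [set t%:E | t in
    [set t : R | 0 < t /\ ~ state_in X t [set y | l < y < r] w]].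

Definition mean_exit_time P X (x l r : R) : \bar R :=
  (\int[P x]_w exit_time X l r w)%E.

End diffusion.

(* Main.v *)
Require Import Defs.
From HB Require Import structures.
From mathcomp Require Import all_boot all_order all_algebra.
From mathcomp Require Import all_classical all_reals all_analysis.
From mathcomp Require Import measurable_realfun.
From mathcomp Require Import ring lra.

(** Let [A = a(x)^2] and let [tau] be the exit time from [(x - h, x + h)].  The
generator maps the parabola [u(y) = K - (y - x)^2] to
[- (a(y)^2 + 2 b(y) (y - x))], which is close to the constant [- A] near [x].
Dynkin's formula then says that [u(x) - E u(X_tau)] is close to [A E tau], and
[u(x) - u] is [h^2] at the end-points, so that [E tau] is about [h^2 / A].

Dynkin's formula is replaced by a discrete version which only uses the Markov
property at deterministic times.  On a grid of step [t], let [B_k] be the event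
that the path stays in the interval during [[0, k t]].  It belongs to the history
at time [k t] ([stays_history]), hence by [markov_property] the sum over [k] of
[E[1_(B_k) (u(X_((k+1) t)) - u(X_(k t)))]] is the sum of
[E[1_(B_k) (P_t u - u)(X_(k t))]].

The first ingredient is that [P_t u - u = - A t] up to [(e + C t) t], uniformly
on the interval, where [e] bounds [|Gu + A|] on a neighbourhood of it
([semigroup_local_expansion]).  The generator is only known
pointwise and boundedly; the uniformity comes from a mean value inequality for
[s |-> P_s u(y)], whose right derivative is [E_y[Gu(X_s)]], together with a
bound [O(s)] on the probability of leaving a neighbourhood before time [s],
obtained by applying the generator to a cutoff.  So the sum above is about
[- A] times [sum_k t P(B_k)], and the latter lies between [E tau] and
[E tau + t] ([mean_exit_time_le_sum], [sum_le_mean_exit_time]).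

The second ingredient is a summation by parts on each path.  If [u >= 0]
everywhere (take [K] slightly larger than [h^2], and truncate the parabola where
it vanishes) the sum of the increments is at least [- u(x) = - K]: this is
[mean_exit_time_upper].  If [u <= 0] outside a slightly smaller interval (take
[K] slightly smaller than [h^2]) the sum is at most [- K] plus [K] times the
probability of a late exit, plus [K] times the probability of being back in the
smaller interval within one time step after the exit; the last one tends to [0]
with [t] since paths are continuous ([no_fast_return]): this is
[mean_exit_time_lower].  Letting the truncation and then [K] tend to their limits
gives [mean_exit_time_sandwich], and the theorem follows since the error [e]
vanishes with [h]. *)

Set Implicit Arguments.
Unset Strict Implicit.
Unset Printing Implicit Defensive.
Import Order.TTheory GRing.Theory Num.Theory.
Import numFieldNormedType.Exports.
Local Open Scope classical_set_scope.
Local Open Scope ring_scope.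

(** * A mean value inequality *)

(** Mean value inequality from the lower right Dini derivative: the largest
[t <= T] with [F t - F 0 <= (K + e) t] cannot be smaller than [T], as the
inequality propagates a little to the right of [t]. *)
Lemma dini_increment_le (R : realType) (F : R -> R) (M K T : R) :
  0 <= T ->
  (forall s t, 0 <= s -> s <= t -> `|F t - F s| <= M * (t - s)) ->
  (forall t e d, 0 <= t -> t < T -> 0 < e -> 0 < d ->
     exists2 h, 0 < h < d & F (t + h) - F t <= (K + e) * h) ->
  F T - F 0 <= K * T.
Proof.
move=> T0 lipF diniF.
suff main e : 0 < e -> F T - F 0 <= (K + e) * T.
  rewrite leNgt; apply/negP => lt.
  have [T0'|T_gt0] := eqVneq T 0; first by move: lt; rewrite T0'; lra.
  have Tp : 0 < T by rewrite lt_neqAle eq_sym T_gt0.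
  pose e := (F T - F 0 - K * T) / 2 / T.
  have ep : 0 < e by rewrite /e !divr_gt0 //; lra.
  have := main _ ep.
  have -> : (K + e) * T = K * T + (F T - F 0 - K * T) / 2 by rewrite /e; field.
  lra.
move=> ep.
have M0 : 0 <= M.
  by have := lipF 0 1 (lexx _) ler01; rewrite subr0 mulr1; apply: le_trans.
pose S := [set t : R | 0 <= t <= T /\ F t - F 0 <= (K + e) * t].
have S0 : S 0 by split; [rewrite lexx | rewrite mulr0 subrr].
have ubS : ubound S T by move=> t [/andP[]].
have supS : has_sup S by split; [exists 0 | exists T].
pose s := sup S.
have s0 : 0 <= s by apply: ub_le_sup => //; exists T.
have sT : s <= T by apply: ge_sup => //; exists 0.
(* the supremum is attained because F is continuous *)
have Ss : F s - F 0 <= (K + e) * s.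
  apply/ler_addgt0Pr => r rp.
  pose C := M + `|K + e| + 1.
  have Cp : 0 < C by rewrite /C; have := normr_ge0 (K + e); lra.
  have [t [/andP[t0 tT] St] tlt] := sup_adherent (divr_gt0 rp Cp) supS.
  have ts : t <= s by apply: ub_le_sup => //; [exists T | split; rewrite ?t0].
  have := lipF _ _ t0 ts; rewrite ler_norml => /andP[_ H].
  have H2 : (K + e) * (t - s) <= `|K + e| * (s - t).
    rewrite -[`|K + e|]normrN.
    have -> : (K + e) * (t - s) = - (K + e) * (s - t) by ring.
    by rewrite ler_wpM2r ?ler_norm//; lra.
  have H3 : (s - t) * C <= r by rewrite -ler_pdivlMr//; rewrite -/s in tlt; lra.
  have H4 : (s - t) * C = M * (s - t) + `|K + e| * (s - t) + (s - t).
    by rewrite /C; ring.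
  lra.
have [->//|/eqP sNT] := eqVneq T s.
have sT' : s < T by rewrite lt_neqAle sT eq_sym; case: eqP sNT.
have [h /andP[h0 hlt] hle] := diniF s e (T - s) s0 sT' ep (ltac:(lra)).
have : S (s + h) by split; [apply/andP; split; lra | lra].
by move=> /(ub_le_sup (ex_intro _ T ubS)); rewrite -/s; lra.
Qed.

(** * Smooth test functions *)

(** The derivatives are carried along so that the closure properties compute
them. *)
Definition smooth2 (R : realType) (f f1 f2 : R -> R) : Prop :=
  [/\ forall x : R, is_derive x 1 f (f1 x),
      forall x : R, is_derive x 1 f1 (f2 x) & continuous f2].

Lemma is_derive_continuous (R : realType) (f f1 : R -> R) :
  (forall x : R, is_derive x 1 f (f1 x)) -> continuous f.
Proof.
by move=> df x; apply: differentiable_continuous; apply/derivable1_diffP.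
Qed.

Lemma smooth2_cst (R : realType) (c : R) :
  smooth2 (cst c) (cst 0) (cst 0).
Proof. by split=> [x|x|x]; [exact: is_derive_cst..|exact: cst_continuous]. Qed.

Lemma smooth2_id (R : realType) : smooth2 (@id R) (cst 1) (cst 0).
Proof.
by split=> [x|x|x]; [exact: is_derive_id|exact: is_derive_cst|
                     exact: cst_continuous].
Qed.

Lemma smooth2B (R : realType) (f f1 f2 g g1 g2 : R -> R) :
  smooth2 f f1 f2 -> smooth2 g g1 g2 ->
  smooth2 (fun x => f x - g x) (fun x => f1 x - g1 x) (fun x => f2 x - g2 x).
Proof.
move=> [df df1 cf] [dg dg1 cg]; split=> x; [exact: is_deriveB..|].
by apply: cvgB; [exact: cf|exact: cg].
Qed.

Lemma smooth2M (R : realType) (f f1 f2 g g1 g2 : R -> R) :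
  smooth2 f f1 f2 -> smooth2 g g1 g2 ->
  smooth2 (fun x => f x * g x) (fun x => f x * g1 x + g x * f1 x)
    (fun x => f x * g2 x + g1 x * f1 x + (g x * f2 x + f1 x * g1 x)).
Proof.
move=> [df df1 cf2] [dg dg1 cg2].
have cf := @is_derive_continuous _ _ _ df.
have cf1 := @is_derive_continuous _ _ _ df1.
have cg := @is_derive_continuous _ _ _ dg.
have cg1 := @is_derive_continuous _ _ _ dg1.
split=> x; [exact: is_deriveM|by apply: is_deriveD; exact: is_deriveM|].
by apply: cvgD; apply: cvgD; apply: cvgM;
  (exact: cf || exact: cf1 || exact: cf2 || exact: cg || exact: cg1 ||
   exact: cg2).
Qed.

Lemma smooth2_comp (R : realType) (f f1 f2 g g1 g2 : R -> R) :
  smooth2 f f1 f2 -> smooth2 g g1 g2 ->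
  smooth2 (fun x => f (g x)) (fun x => f1 (g x) * g1 x)
    (fun x => f1 (g x) * g2 x + g1 x * (f2 (g x) * g1 x)).
Proof.
move=> [df df1 cf2] [dg dg1 cg2].
have cf1 := @is_derive_continuous _ _ _ df1.
have cg := @is_derive_continuous _ _ _ dg.
have cg1 := @is_derive_continuous _ _ _ dg1.
split=> x; [exact: is_derive1_comp|by apply: is_deriveM;
  exact: (is_derive1_comp (f := f1))|].
apply: cvgD; apply: cvgM.
- by apply: (cvg_comp g f1 (cg x)); exact: cf1.
- exact: cg2.
- exact: cg1.
- by apply: cvgM; [apply: (cvg_comp g f2 (cg x)); exact: cf2|exact: cg1].
Qed.

Lemma is_derive_max0X (R : realType) (n : nat) (x : R) :
  is_derive x 1 (fun z : R => Num.max z 0 ^+ n.+2)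
    (n.+2%:R * Num.max x 0 ^+ n.+1).
Proof.
have [x0|x0|->] := ltgtP x 0.
- rewrite expr0n /= mulr0.
  apply: (near_eq_is_derive (f := cst (0 : R))).
  near=> z; have z0 : z < 0 by near: z; exact: lt_nbhsl.
  by rewrite /= (max_r (ltW z0)) expr0n.
- apply: (near_eq_is_derive (f := fun z : R => z ^+ n.+2)).
    near=> z; have z0 : 0 < z by near: z; exact: lt_nbhsr.
    by rewrite /= (max_l (ltW z0)).
  have := is_deriveX n.+2 (is_derive_id x (1 : R)).
  by rewrite /= -[_ *: 1]/(_ * 1) mulr1 exprfctE.
rewrite expr0n /= mulr0.
suff H : h^-1 *: (((fun z : R => Num.max z 0 ^+ n.+2) \o shift 0) (h *: 1)
           - Num.max 0 0 ^+ n.+2) @[h --> (0 : R)^'] --> (0 : R).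
  by split; [apply: cvgP H | exact: cvg_lim H].
apply/cvgrPdist_le => e e0; near=> h.
have h0 : h != 0 by near: h; exact: nbhs_dnbhs_neq.
have h1 : `|h| <= Num.min 1 e.
  near: h; apply: dnbhs0_le; rewrite lt_min ltr01 e0//.
have [h11 h1e] : `|h| <= 1 /\ `|h| <= e by move: h1; rewrite le_min => /andP[].
rewrite /= maxxx expr0n subr0 sub0r normrN -[h *: 1]/(h * 1) mulr1 addr0.
rewrite -[_ *: _]/(_ * _) normrM normfV ler_pdivrMl ?normr_gt0//.
apply: (@le_trans _ _ (`|h| ^+ n.+2)).
  rewrite normrX lerXn2r ?nnegrE//.
  by have [hp|hn] := leP h 0; rewrite ?normr0.
rewrite exprS ler_wpM2l// exprS (le_trans _ h1e)// ler_piMr//.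
by rewrite exprn_ile1.
Unshelve. all: by end_near. Qed.

Lemma smooth2_cube (R : realType) :
  smooth2 (fun z : R => Num.max z 0 ^+ 3) (fun z => 3 * Num.max z 0 ^+ 2)
    (fun z => 3 * (2 * Num.max z 0 ^+ 1)).
Proof.
split=> x; [exact: is_derive_max0X| |].
  exact: (@is_deriveZ _ _ _ _ 3%R _ _ _ (is_derive_max0X 0 x)).
apply: cvgM; first exact: cvg_cst.
apply: cvgM; first exact: cvg_cst.
by apply: continuous_max; [exact: cvg_id|exact: cvg_cst].
Qed.

(** With [c(z) = max(z, 0)^3], which is [C^2], the function [1 - c(1 - c(z))] is a
[C^2] step, equal to [0] for [z <= 0] and to [1] for [z >= 1]; it is composed
with a concave parabola which is [1] at distance [r1] and [0] at distance
[r2] of [x0]. *)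
Lemma smooth_cutoff (R : realType) (x0 r1 r2 : R) : 0 < r1 -> r1 < r2 ->
  exists p p1 p2 : R -> R,
    [/\ smooth2 p p1 p2, forall x, 0 <= p x <= 1,
        forall x, `|x - x0| <= r1 -> p x = 1 &
        forall x, r2 <= `|x - x0| -> p x = 0].
Proof.
move=> r10 r12.
have sc := smooth2_cube R.
have s1 := smooth2_cst (1 : R).
have sx := smooth2B (smooth2_id R) (smooth2_cst x0).
pose m := (r2 ^+ 2 - r1 ^+ 2)^-1.
have m0 : 0 < r2 ^+ 2 - r1 ^+ 2.
  by rewrite subr_gt0 ltrXn2r ?nnegrE ?(ltW r10)//; lra.
have sq := smooth2M (smooth2B (smooth2_cst (r2 ^+ 2)) (smooth2M sx sx))
   (smooth2_cst m).
have := smooth2B s1 (smooth2_comp sc (smooth2B s1 (smooth2_comp sc sq))).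
set p := (X in smooth2 X _ _); set p1 := (X in smooth2 _ X _).
set p2 := (X in smooth2 _ _ X) => sp.
have c01 (z : R) : z <= 0 -> Num.max z 0 ^+ 3 = 0.
  by move=> z0; rewrite (max_r z0) expr0n.
have c0 (z : R) : 0 <= Num.max z 0 ^+ 3.
  by rewrite exprn_ge0// le_max lexx orbT.
have c1 (z : R) : 1 <= z -> 1 <= Num.max z 0 ^+ 3.
  by move=> z1; rewrite max_l ?(le_trans _ z1)// expr_ge1// (le_trans _ z1).
have c2 (z : R) : z <= 1 -> Num.max z 0 ^+ 3 <= 1.
  move=> z1; rewrite exprn_ile1 ?le_max ?lexx ?orbT// ge_max z1; exact: ler01.
exists p, p1, p2; split=> // x; rewrite /p /=.
- rewrite subr_ge0 c2 /=; last by rewrite gerBl.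
  by rewrite gerBl.
- move=> xr; rewrite c01 ?subr0// subr_le0 c1//.
  rewrite -/m ler_pdivlMr// mul1r lerD2l lerN2 -expr2.
  by rewrite -(real_normK (num_real (x - x0))) lerXn2r ?nnegrE// ltW.
- move=> xr.
  rewrite (c01 (_ * m)); last by rewrite pmulr_lle0 ?invr_gt0// subr_le0
    -expr2 -(real_normK (num_real (x - x0))) lerXn2r ?nnegrE//; lra.
  by rewrite subr0 (max_l ler01) expr1n subrr.
Qed.

Lemma smooth2_derive1 (R : realType) (f f1 f2 : R -> R) :
  smooth2 f f1 f2 -> derive1 f = f1 /\ derive1n 2 f = f2.
Proof.
move=> [df df1 _].
have E (g g1 : R -> R) : (forall x : R, is_derive x 1 g (g1 x)) -> derive1 g = g1.
  by move=> dg; apply/funext => x; rewrite derive1E derive_val.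
by rewrite derive1nS derive1n1 (E _ _ df) (E _ _ df1).
Qed.

Lemma smooth2_C2c (R : realType) (U : set R) (f f1 f2 : R -> R) (x0 r : R) :
  smooth2 f f1 f2 -> (forall x, r <= `|x - x0| -> f x = 0) ->
  (forall x, `|x - x0| <= r -> U x) -> C2c U f.
Proof.
move=> sf f0 sU; have [e1 e2] := smooth2_derive1 sf; case: sf => df df1 cf2.
split=> [x|x||]; first exact: (@ex_derive _ _ _ _ _ _ _ (df x)).
- by rewrite e1; exact: (@ex_derive _ _ _ _ _ _ _ (df1 x)).
- by rewrite e2.
exists [set` `[x0 - r, x0 + r]]; split; first exact: segment_compact.
  by move=> x /=; rewrite in_itv /= -ler_distl => /sU.
move=> x /=; rewrite in_itv /= -ler_distl => /negP; rewrite -ltNge => /ltW.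
exact: f0.
Qed.

Lemma diff_op_parabola (R : realType) (a b p p1 p2 : R -> R) (x0 r1 K y : R) :
  smooth2 p p1 p2 -> (forall x, `|x - x0| <= r1 -> p x = 1) ->
  `|y - x0| < r1 ->
  diff_op a b (fun x => (K - (x - x0) * (x - x0)) * p x) y
  = - (a y ^+ 2 + 2 * b y * (y - x0)).
Proof.
move=> sp p1E yr.
have sx := smooth2B (smooth2_id R) (smooth2_cst x0).
have sq := smooth2B (smooth2_cst K) (smooth2M sx sx).
have nbd (z : R) : `|z - x0| < r1 -> \forall x \near z, `|x - x0| < r1.
  move=> zr; have zr' : 0 < r1 - `|z - x0| by rewrite subr_gt0.
  apply/nbhs_ballP; exists (r1 - `|z - x0|) => //= x; rewrite /ball /= => H.
  have := ler_distD z x x0; rewrite (distrC x z); lra.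
pose q (x : R) := K - (x - x0) * (x - x0).
have [dq1 dq2] := smooth2_derive1 sq.
have eq0 (z : R) : `|z - x0| < r1 ->
    \forall x \near z, q x * p x = q x.
  by move=> /nbd; apply: filterS => x /ltW /p1E ->; rewrite mulr1.
have eq1 (z : R) : `|z - x0| < r1 ->
    derive1 (fun x => q x * p x) z = derive1 q z.
  move=> zr; rewrite !derive1E; apply: near_eq_derive; exact: eq0.
have eq2 : derive1n 2 (fun x => q x * p x) y = derive1n 2 q y.
  rewrite !derive1nS !derive1n0 !(derive1E (derive1 _)); apply: near_eq_derive.
  by have := nbd _ yr; apply: filterS => z /eq1.
by rewrite /diff_op (eq1 _ yr) eq2 dq1 dq2 /=; field.
Qed.

(** * Bounded random variables *)

Section bounded_random_variables.
Context (d : measure_display) (T : measurableType d) (R : realType).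

Definition bounded_rv (Z : T -> R) : Prop :=
  measurable_fun setT Z /\ exists M : R, forall w, `|Z w| <= M.

Lemma bounded_rv_cst (c : R) : bounded_rv (fun=> c).
Proof. by split; [exact: measurable_cst | exists `|c|]. Qed.

Lemma bounded_rv_indic (A : set T) : measurable A -> bounded_rv \1_A.
Proof.
move=> mA; split; first exact: measurable_indic.
exists 1 => w; rewrite indicE; case: (_ \in _); rewrite ?normr1 ?normr0//.
Qed.

Lemma bounded_rvB (Y Z : T -> R) :
  bounded_rv Y -> bounded_rv Z -> bounded_rv (fun w => Y w - Z w).
Proof.
move=> [mY [M YM]] [mZ [N ZN]]; split; first exact: measurable_funB.
exists (M + N) => w; apply: (le_trans (ler_normB _ _)); exact: lerD.
Qed.

Lemma bounded_rvD (Y Z : T -> R) :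
  bounded_rv Y -> bounded_rv Z -> bounded_rv (fun w => Y w + Z w).
Proof.
move=> [mY [M YM]] [mZ [N ZN]]; split; first exact: measurable_funD.
exists (M + N) => w; apply: (le_trans (ler_normD _ _)); exact: lerD.
Qed.

Lemma bounded_rvM (Y Z : T -> R) :
  bounded_rv Y -> bounded_rv Z -> bounded_rv (fun w => Y w * Z w).
Proof.
move=> [mY [M YM]] [mZ [N ZN]]; split; first exact: measurable_funM.
by exists (M * N) => w; rewrite normrM; apply: ler_pM.
Qed.

Lemma bounded_rvZ (c : R) (Z : T -> R) :
  bounded_rv Z -> bounded_rv (fun w => c * Z w).
Proof. exact/bounded_rvM/bounded_rv_cst. Qed.

Lemma bounded_rv_sum (J : Type) (s : seq J) (Z : J -> T -> R) :
  (forall j, bounded_rv (Z j)) -> bounded_rv (fun w => \sum_(j <- s) Z j w).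
Proof.
move=> bZ; elim: s => [|j s IH].
  by under eq_fun do rewrite big_nil; exact: bounded_rv_cst.
by under eq_fun do rewrite big_cons; exact: bounded_rvD.
Qed.

Variable mu : probability T R.

Lemma bounded_rv_integrable (Z : T -> R) :
  bounded_rv Z -> mu.-integrable setT (EFin \o Z).
Proof.
move=> [mZ [M ZM]]; apply: measurable_bounded_integrable => //.
  exact: le_lt_trans (probability_le1 mu measurableT) (ltry _).
exists M; split; first exact: num_real.
by move=> N MN w _; exact: le_trans (ZM w) (ltW MN).
Qed.

Lemma expect_cst (c : R) : \int[mu]_w c = c.
Proof.
rewrite Rintegral_cst//; have -> : fine (mu setT) = 1; last exact: mulr1.
by rewrite [X in fine X](probability_setT mu).
Qed.

Lemma expect_indic (A : set T) : measurable A ->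
  \int[mu]_w \1_A w = fine (mu A).
Proof. by move=> mA; rewrite /Rintegral integral_indic// setIT. Qed.

Lemma expectB (Y Z : T -> R) : bounded_rv Y -> bounded_rv Z ->
  \int[mu]_w (Y w - Z w) = \int[mu]_w Y w - \int[mu]_w Z w.
Proof. by move=> bY bZ; apply: RintegralB => //; exact: bounded_rv_integrable. Qed.

Lemma expectD (Y Z : T -> R) : bounded_rv Y -> bounded_rv Z ->
  \int[mu]_w (Y w + Z w) = \int[mu]_w Y w + \int[mu]_w Z w.
Proof. by move=> bY bZ; apply: RintegralD => //; exact: bounded_rv_integrable. Qed.

Lemma expectZ (c : R) (Z : T -> R) : bounded_rv Z ->
  \int[mu]_w (c * Z w) = c * \int[mu]_w Z w.
Proof. by move=> bZ; apply: RintegralZl => //; exact: bounded_rv_integrable. Qed.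

Lemma expect_sum (J : Type) (s : seq J) (Z : J -> T -> R) :
  (forall j, bounded_rv (Z j)) ->
  \int[mu]_w (\sum_(j <- s) Z j w) = \sum_(j <- s) \int[mu]_w Z j w.
Proof.
move=> bZ; elim: s => [|j s IH].
  by under eq_Rintegral do rewrite big_nil; rewrite expect_cst big_nil.
under eq_Rintegral do rewrite big_cons.
by rewrite expectD// ?IH ?big_cons//; exact: bounded_rv_sum.
Qed.

Lemma expect_le (Y Z : T -> R) : bounded_rv Y -> bounded_rv Z ->
  (forall w, Y w <= Z w) -> \int[mu]_w Y w <= \int[mu]_w Z w.
Proof.
by move=> bY bZ YZ; apply: le_Rintegral => //; exact: bounded_rv_integrable.
Qed.

Lemma expect_norm_le (Z : T -> R) (M : R) : measurable_fun setT Z ->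
  (forall w, `|Z w| <= M) -> `|\int[mu]_w Z w| <= M.
Proof.
move=> mZ ZM; have bZ : bounded_rv Z by split=> //; exists M.
rewrite -[X in _ <= X]expect_cst; apply: (le_trans (le_normr_Rintegral _ _)) => //.
  exact: bounded_rv_integrable.
apply: expect_le => //; last exact: bounded_rv_cst.
by split; [exact: measurableT_comp | exists M => w; rewrite normr_id].
Qed.

Lemma expect_bounded_cvg (Z_ : nat -> T -> R) (Z : T -> R) (M : R) :
  (forall n, measurable_fun setT (Z_ n)) -> (forall n w, `|Z_ n w| <= M) ->
  (forall w, Z_ n w @[n --> \oo] --> Z w) ->
  (\int[mu]_w Z_ n w) @[n --> \oo] --> \int[mu]_w Z w.
Proof.
move=> mZ_ Z_M cZ.
have mZ : measurable_fun setT Z by apply: measurable_fun_cvg => // w _; exact: cZ.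
apply: fine_cvg.
have ZM w : `|Z w| <= M.
  rewrite -(cvg_lim (@Rhausdorff R) (cvg_norm (cZ w))); apply: limr_le.
    by apply: cvgP; apply: cvg_norm; exact: cZ.
  by apply: nearW => n; exact: Z_M.
rewrite fineK; last first.
  by apply: integrable_fin_num => //; apply: bounded_rv_integrable; split=> //; exists M.
have [|||||_ _ //] := @dominated_convergence _ _ _ mu _ measurableT
  (fun n w => (Z_ n w)%:E) (fun w => (Z w)%:E) (fun=> M%:E).
- by move=> n; exact/measurable_EFinP.
- exact/measurable_EFinP.
- by apply: aeW => w _; apply: cvg_EFin; [exact: nearW | exact: cZ].
- exact: (bounded_rv_integrable (bounded_rv_cst M)).
- by apply: aeW => w n _; rewrite lee_fin.
Qed.

Lemma expect_ae_cst (A : set T) (Z : T -> R) (c : R) :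
  measurable A -> mu A = 1%E -> measurable_fun setT Z ->
  (forall w, A w -> Z w = c) -> \int[mu]_w Z w = c.
Proof.
move=> mA A1 mZ ZA; rewrite -[RHS]expect_cst; congr fine.
apply: ae_eq_integral => //; first exact/measurable_EFinP.
exists (~` A); split; first exact: measurableC.
  rewrite [LHS]probability_setC// A1 subee//.
by move=> w /=; apply: contra_not => Aw _; rewrite ZA.
Qed.

End bounded_random_variables.

(** * The simple Markov property *)

Definition extend0 (R : realType) (f : R -> R) (o : option R) : R :=
  if o is Some y then f y else 0.

Section markov.
Context (d : measure_display) (Omega : measurableType d) (R : realType).
Context (I : set R) (P : R -> probability Omega R).
Context (X : R -> Omega -> option R) (hX : regular_diffusion I P X).
Import HBNNSimple.

Lemma measurable_extend0 (t : R) (f : R -> R) : 0 <= t ->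
  measurable_fun I f -> measurable_fun setT (fun w => extend0 f (X t w)).
Proof.
move=> t0 mf _ B mB; rewrite setTI.
have -> : (fun w => extend0 f (X t w)) @^-1` B =
    state_in X t (I `&` f @^-1` B) `|`
    (~` state_in X t setT `&` [set w | B 0]).
  apply/seteqP; split=> w; rewrite /state_in /= /extend0.
    case E : (X t w) => [y|] Bw; last by right; split=> // -[z].
    left; exists y => //; split=> //; exact: (diffusion_state hX t0 E).
  by move=> [[y [Iy Bf] <-] //|[]]; case: (X t w) => // y nX; case: nX; exists y.
have mI : measurable I := is_interval_measurable (diffusion_interval hX).
apply: measurableU; first by apply: (diffusion_measurable hX) => //; exact: mf.
apply: measurableI; first by apply: measurableC; exact: (diffusion_measurable hX).
have [B0|B0] := pselect (B 0).
  by rewrite (_ : [set _ | _] = setT)//; apply/seteqP; split.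
by rewrite (_ : [set _ | _] = set0)//; apply/seteqP; split.
Qed.

Lemma norm_extend0_le (t : R) (f : R -> R) (M : R) (w : Omega) : 0 <= t ->
  (forall y, I y -> `|f y| <= M) -> 0 <= M -> `|extend0 f (X t w)| <= M.
Proof.
move=> t0 fM M0; case E : (X t w) => [y|] /=; last by rewrite normr0.
exact/fM/(diffusion_state hX t0 E).
Qed.

Lemma bounded_extend0 (t : R) (f : R -> R) (M : R) : 0 <= t ->
  measurable_fun I f -> (forall y, I y -> `|f y| <= M) -> 0 <= M ->
  bounded_rv (fun w => extend0 f (X t w)).
Proof.
move=> t0 mf fM M0; split; first exact: measurable_extend0.
by exists M => w; exact: norm_extend0_le.
Qed.

Lemma history_measurable (s : R) (A : set Omega) : history X s A -> measurable A.
Proof.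
apply: smallest_sub; first exact: sigma_algebra_measurable.
move=> _ [t [B [/= /andP[t0 _] mB ->]]]; exact: (diffusion_measurable hX).
Qed.

Lemma history_mono (s t : R) (A : set Omega) : s <= t ->
  history X s A -> history X t A.
Proof.
move=> st; rewrite /history /natural_sigma.
apply: sub_sigma_algebra2 => _ [r [B [/= /andP[r0 rs] mB ->]]].
by exists r, B; split=> //=; rewrite r0 (le_trans rs).
Qed.

Lemma extend0_indic (t : R) (B : set R) (w : Omega) :
  extend0 \1_B (X t w) = \1_(state_in X t B) w.
Proof.
rewrite !indicE /state_in; case E : (X t w) => [y|] /=.
  congr (nat_of_bool _)%:R; apply/idP/idP; rewrite !inE /= E.
    by move=> By; exists y.
  by move=> [z Bz [<-]].
by rewrite memNset//= E => -[].
Qed.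

Lemma semigroup_indic (t : R) (B : set R) (x : R) : 0 <= t -> measurable B ->
  semigroup P X t \1_B x = fine (P x (state_in X t B)).
Proof.
move=> t0 mB; rewrite -expect_indic; last exact: (diffusion_measurable hX).
by apply: eq_Rintegral => w _; rewrite -extend0_indic.
Qed.

(* The class of test functions for which the Markov property holds: it contains
   the indicators by the strong Markov property at constant times, and it is
   stable under linear combinations and bounded limits. *)
Let markov_fun (t : R) (f : R -> R) : Prop :=
  [/\ measurable_fun setT f, (exists M, forall y, `|f y| <= M),
      measurable_fun I (semigroup P X t f) &
      forall x s (A : set Omega), I x -> 0 <= s -> history X s A ->
        \int[P x]_w (\1_A w * extend0 f (X (s + t) w)) =
        \int[P x]_w (\1_A w * extend0 (semigroup P X t f) (X s w))].

Let markov_funS (f : R -> R) : measurable_fun setT f -> measurable_fun I f.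
Proof. by move=> mf; apply: measurable_funS mf. Qed.

Let markov_indic (t : R) (B : set R) : 0 <= t -> measurable B ->
  markov_fun t \1_B.
Proof.
move=> t0 mB.
have mt : measurable_fun I (semigroup P X t \1_B).
  rewrite (_ : semigroup _ _ _ _ = fine \o (fun x => P x (state_in X t B))).
    apply: measurableT_comp; first exact: fine_measurable.
    apply: (diffusion_measurable_law hX).
    by apply: sub_sigma_algebra; exists t, B.
  by apply/funext => x; rewrite semigroup_indic.
split; first exact: measurable_indic.
- exists 1 => y; rewrite indicE; case: (_ \in _); rewrite ?normr1 ?normr0//.
- exact: mt.
move=> x s A Ix s0 hA.
have mtau : markov_time X (fun=> s%:E).
  split=> [w|t' t'0]; first by rewrite lee_fin.
  have [st|st] := ltP s t'.
    rewrite (_ : [set _ | _] = setT); last first.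
      by apply/seteqP; split=> // w _; rewrite /= lte_fin.
    by rewrite -setC0 -setTD; apply: sigma_algebraCD; exact: sigma_algebra0.
  rewrite (_ : [set _ | _] = set0); first exact: sigma_algebra0.
  by apply/seteqP; split=> // w; rewrite /= lte_fin ltNge st.
have hpA : history_plus X (fun=> s%:E) A.
  move=> t' t'0; have [st|st] := ltP s t'.
    rewrite (_ : _ `&` _ = A); first exact: (history_mono (ltW st)).
    by apply/seteqP; split=> [w []//|w Aw]; split=> //=; rewrite lte_fin.
  rewrite (_ : _ `&` _ = set0); first exact: sigma_algebra0.
  by apply/seteqP; split=> // w []; rewrite /= lte_fin ltNge st.
have mA := history_measurable hA.
have mst := diffusion_measurable hX (addr_ge0 s0 t0) mB.
have := diffusion_strong_markov hX Ix mtau hpA t0 mB => /=.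
rewrite (_ : A `&` [set _ | _ /\ _] = A `&` state_in X (s + t) B); last first.
  by apply/seteqP; split=> w [Aw]; [case|split=> //; rewrite ltry].
rewrite (_ : A `&` [set _ | _] = A); last first.
  by apply/seteqP; split=> [w []//|w Aw]; split=> //=; rewrite ltry.
move=> /(congr1 fine) E.
transitivity (fine (P x (A `&` state_in X (s + t) B))).
  rewrite -expect_indic; last exact: measurableI.
  by apply: eq_Rintegral => w _; rewrite extend0_indic indicI.
rewrite E integral_mkcond; congr fine; apply: eq_integral => w _.
rewrite patchE indicE; case: ifP => _ /=; last by rewrite mul0r.
rewrite mul1r; case: (X s w) => [y|] //=.
by rewrite semigroup_indic// fineK// fin_num_measure//; exact: (diffusion_measurable hX).
Qed.

Let markov_lin (t c : R) (f g : R -> R) : 0 <= t ->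
  markov_fun t f -> markov_fun t g -> markov_fun t (fun y => c * f y + g y).
Proof.
move=> t0 [mf [M fM] mPf Ef] [mg [N gN] mPg Eg].
have M0 : 0 <= M := le_trans (normr_ge0 _) (fM 0).
have N0 : 0 <= N := le_trans (normr_ge0 _) (gN 0).
have lin (u v : R -> R) o :
    extend0 (fun y => c * u y + v y) o = c * extend0 u o + extend0 v o.
  by case: o => //=; rewrite mulr0 addr0.
have bf r : 0 <= r -> bounded_rv (fun w => extend0 f (X r w)).
  by move=> r0; apply: (@bounded_extend0 _ _ M) => //; exact: markov_funS.
have bg r : 0 <= r -> bounded_rv (fun w => extend0 g (X r w)).
  by move=> r0; apply: (@bounded_extend0 _ _ N) => //; exact: markov_funS.
have PE : semigroup P X t (fun y => c * f y + g y) =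
    fun y => c * semigroup P X t f y + semigroup P X t g y.
  apply/funext => y; rewrite /semigroup -(@expectZ _ _ _ _ c); last exact: bf.
  rewrite -expectD; [|exact/bounded_rvZ/bf|exact: bg].
  by apply: eq_Rintegral => w _; exact: lin.
split.
- by apply: measurable_funD => //; apply: measurable_funM => //.
- exists (`|c| * M + N) => y; apply: (le_trans (ler_normD _ _)).
  by rewrite lerD// normrM ler_wpM2l.
- by rewrite PE; apply: measurable_funD => //; apply: measurable_funM => //.
move=> x s A Ix s0 hA; rewrite PE.
have bA : bounded_rv (\1_A : Omega -> R) := bounded_rv_indic R (history_measurable hA).
have bPf : bounded_rv (fun w => extend0 (semigroup P X t f) (X s w)).
  apply: (@bounded_extend0 _ _ M) => // y _; apply: expect_norm_le.
    exact: (bf t t0).1.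
  by move=> w; apply: norm_extend0_le.
have bPg : bounded_rv (fun w => extend0 (semigroup P X t g) (X s w)).
  apply: (@bounded_extend0 _ _ N) => // y _; apply: expect_norm_le.
    exact: (bg t t0).1.
  by move=> w; apply: norm_extend0_le.
have st0 := addr_ge0 s0 t0.
have key (u v : Omega -> R) : bounded_rv u -> bounded_rv v ->
    \int[P x]_w (\1_A w * (c * u w + v w)) =
    c * \int[P x]_w (\1_A w * u w) + \int[P x]_w (\1_A w * v w).
  move=> bu bv; rewrite -expectZ; last exact: bounded_rvM.
  rewrite -expectD; [|exact/bounded_rvZ/bounded_rvM|exact: bounded_rvM].
  by apply: eq_Rintegral => w _; ring.
under eq_Rintegral do rewrite lin.
under [RHS]eq_Rintegral do rewrite lin.
rewrite (key _ _ (bf _ st0) (bg _ st0)) (key _ _ bPf bPg).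
by rewrite Ef// Eg.
Qed.

Let markov_lim (t M : R) (f_ : nat -> R -> R) (f : R -> R) : 0 <= t ->
  (forall n, markov_fun t (f_ n)) -> (forall n y, `|f_ n y| <= M) ->
  (forall y, f_ n y @[n --> \oo] --> f y) -> markov_fun t f.
Proof.
move=> t0 Mf_ f_M cf.
have M0 : 0 <= M := le_trans (normr_ge0 _) (f_M 0 0).
have mf : measurable_fun setT f.
  by apply: measurable_fun_cvg => [n|y _]; [case: (Mf_ n) | exact: cf].
have fM y : `|f y| <= M.
  rewrite -(cvg_lim (@Rhausdorff R) (cvg_norm (cf y))); apply: limr_le.
    by apply: cvgP; apply: cvg_norm; exact: cf.
  by apply: nearW => n; exact: f_M.
have mX n r : 0 <= r -> measurable_fun setT (fun w => extend0 (f_ n) (X r w)).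
  by move=> r0; apply: measurable_extend0 => //; apply: markov_funS; case: (Mf_ n).
have cX r w : extend0 (f_ n) (X r w) @[n --> \oo] --> extend0 f (X r w).
  by case: (X r w) => [y|] /=; [exact: cf | exact: cvg_cst].
have cP y : semigroup P X t (f_ n) y @[n --> \oo] --> semigroup P X t f y.
  apply: (@expect_bounded_cvg _ _ _ _ _ _ M) => [n|n w|w].
  - exact: mX.
  - exact: norm_extend0_le.
  - exact: cX.
have PM n y : `|semigroup P X t (f_ n) y| <= M.
  by apply: expect_norm_le; [exact: mX | move=> w; exact: norm_extend0_le].
split=> //; first by exists M.
  by apply: measurable_fun_cvg => [n|y _]; [case: (Mf_ n) | exact: cP].
move=> x s A Ix s0 hA.
have bA : bounded_rv (\1_A : Omega -> R) := bounded_rv_indic R (history_measurable hA).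
have key (Z_ : nat -> Omega -> R) (Z : Omega -> R) :
    (forall n, measurable_fun setT (Z_ n)) -> (forall n w, `|Z_ n w| <= M) ->
    (forall w, Z_ n w @[n --> \oo] --> Z w) ->
    (\int[P x]_w (\1_A w * Z_ n w)) @[n --> \oo] --> \int[P x]_w (\1_A w * Z w).
  move=> mZ ZM cZ; apply: (@expect_bounded_cvg _ _ _ _ _ _ M) => [n|n w|w].
  - by apply: measurable_funM => //; exact: bA.1.
  - rewrite normrM -[M]mul1r ler_pM// indicE.
    by case: (_ \in _); rewrite ?normr1 ?normr0.
  - by apply: cvgM; [exact: cvg_cst | exact: cZ].
have st0 := addr_ge0 s0 t0.
have c1 := key _ _ (fun n => mX n _ st0)
  (fun n w => norm_extend0_le w st0 (fun y _ => f_M n y) M0) (cX (s + t)).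
have c2 := key (fun n w => extend0 (semigroup P X t (f_ n)) (X s w))
  (fun w => extend0 (semigroup P X t f) (X s w)) _ _ _.
apply: (cvg_unique (@Rhausdorff R) c1).
have -> : (fun n => \int[P x]_w (\1_A w * extend0 (f_ n) (X (s + t) w))) =
  (fun n => \int[P x]_w (\1_A w * extend0 (semigroup P X t (f_ n)) (X s w))).
  by apply/funext => n; case: (Mf_ n) => _ _ _; exact.
apply: c2 => [n|n w|w].
- by apply: measurable_extend0 => //; case: (Mf_ n).
- exact: norm_extend0_le.
- by case: (X s w) => [y|] /=; [exact: cP | exact: cvg_cst].
Qed.

Let markov_bounded (t : R) (f : R -> R) (M : R) : 0 <= t ->
  measurable_fun setT f -> (forall y, `|f y| <= M) -> markov_fun t f.
Proof.
move=> t0 mf fM.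
have mk0 : markov_fun t (fun=> 0).
  have -> : (fun=> 0) = (\1_(set0 : set R) : R -> R).
    by apply/funext => y; rewrite indicE in_set0.
  exact: markov_indic.
have mk1 : markov_fun t (fun=> 1).
  have -> : (fun=> 1) = (\1_(setT : set R) : R -> R).
    by apply/funext => y; rewrite indicE in_setT.
  exact: markov_indic.
have M0 : 0 <= M := le_trans (normr_ge0 _) (fM 0).
(* simple functions approximate nonnegative functions *)
pose g y := f y + M.
have g0 y : 0 <= g y by rewrite /g; have := fM y; rewrite ler_norml; lra.
have gM y : g y <= 2 * M by rewrite /g; have := fM y; rewrite ler_norml; lra.
suff mkg : markov_fun t g.
  have -> : f = (fun y => (- M) * 1 + g y) by apply/funext => y; rewrite /g; ring.
  exact: (markov_lin (- M) t0 mk1 mkg).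
have mg : measurable_fun setT (EFin \o g).
  by apply/measurable_EFinP; apply: measurable_funD => //; exact: measurable_cst.
have ge0 y : setT y -> (0 <= (EFin \o g) y)%E by move=> _; rewrite /= lee_fin.
pose f_ n : {nnsfun R >-> R} := nnsfun_approx measurableT mg n.
apply: (@markov_lim t (2 * M) (fun n y => f_ n y) g t0).
- move=> n.
  have -> : (f_ n : R -> R) = fun y =>
      \sum_(z <- finmap.enum_fset (fset_set (range (f_ n))))
      z * \1_(f_ n @^-1` [set z]) y.
    apply/funext => y; rewrite fimfunE fsbig_finite//.
  elim: (finmap.enum_fset _) => [|z s IH].
    by under eq_fun do rewrite big_nil; exact: mk0.
  under eq_fun do rewrite big_cons.
  apply: (markov_lin z t0 _ IH); apply: (markov_indic t0).
  exact: measurable_sfunP.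
- move=> n y; rewrite ger0_norm//; apply: le_trans (gM y).
  by rewrite -lee_fin /f_ nnsfun_approxE; apply: (@le_approx _ _ _ setT (EFin \o g)).
- move=> y; rewrite /f_; under eq_fun do rewrite nnsfun_approxE.
  by apply: (@cvg_approx _ _ _ setT (EFin \o g)) => //=; rewrite ltry.
Qed.

Lemma semigroup_measurable (t : R) (f : R -> R) (M : R) : 0 <= t ->
  measurable_fun setT f -> (forall y, `|f y| <= M) ->
  measurable_fun I (semigroup P X t f).
Proof. by move=> t0 mf fM; case: (markov_bounded t0 mf fM). Qed.

Lemma markov_property (x s t M : R) (A : set Omega) (f : R -> R) :
  I x -> 0 <= s -> 0 <= t -> history X s A ->
  measurable_fun setT f -> (forall y, `|f y| <= M) ->
  \int[P x]_w (\1_A w * extend0 f (X (s + t) w)) =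
  \int[P x]_w (\1_A w * extend0 (semigroup P X t f) (X s w)).
Proof.
by move=> Ix s0 t0 hA mf fM; case: (markov_bounded t0 mf fM) => _ _ _; exact.
Qed.

End markov.

(** * Short-time behaviour of the semigroup *)

Section generator.
Context (d : measure_display) (Omega : measurableType d) (R : realType).
Context (I : set R) (P : R -> probability Omega R).
Context (X : R -> Omega -> option R) (a b : R -> R).
Context (hX : regular_diffusion I P X) (hG : associated_operator I P X a b).

Lemma C2c_bounded (u : R -> R) : C2c (interior I) u ->
  measurable_fun setT u /\ exists M, forall y, `|u y| <= M.
Proof.
move=> Cu; have [[_ [M uM]] _ _ _] := hG Cu; case: Cu => du _ _ [K [_ KI u0]].
split.
  apply: continuous_measurable_fun => x.
  by apply: differentiable_continuous; apply/derivable1_diffP.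
exists `|M| => y; have [Iy|nIy] := pselect (I y).
  exact: le_trans (uM y Iy) (ler_norm _).
rewrite u0 ?normr0// => Ky; apply: nIy; exact: (interior_subset (KI _ Ky)).
Qed.

Lemma generator_measurable (u : R -> R) : C2c (interior I) u ->
  measurable_fun I (diff_op a b u).
Proof.
move=> /hG [_ [cg _] _ _]; apply: subspace_continuous_measurable_fun => //.
exact: is_interval_measurable (diffusion_interval hX).
Qed.

Lemma semigroup_start (u : R -> R) (y : R) : I y -> measurable_fun setT u ->
  semigroup P X 0 u y = u y.
Proof.
move=> Iy mu; apply: (@expect_ae_cst _ _ _ _ (state_in X 0 [set y])).
- exact: (diffusion_measurable hX).
- exact: (diffusion_start hX).
- by apply: (measurable_extend0 hX) => //; apply: measurable_funS mu.
- by move=> w [_ /= -> <-].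
Qed.

Lemma semigroup_increment (u : R -> R) (y s t : R) :
  C2c (interior I) u -> I y -> 0 <= s -> 0 <= t ->
  semigroup P X (s + t) u y - semigroup P X s u y =
  \int[P y]_w extend0 (fun z => semigroup P X t u z - u z) (X s w).
Proof.
move=> Cu Iy s0 t0; have [mu [M uM]] := C2c_bounded Cu.
have M0 : 0 <= M := le_trans (normr_ge0 _) (uM 0).
have hT : history X s setT.
  by rewrite -setC0 -setTD; apply: sigma_algebraCD; exact: sigma_algebra0.
have muI : measurable_fun I u by apply: measurable_funS mu.
have mk := markov_property hX Iy s0 t0 hT mu uM.
have E : semigroup P X (s + t) u y =
    \int[P y]_w extend0 (semigroup P X t u) (X s w).
  transitivity (\int[P y]_w (\1_setT w * extend0 u (X (s + t) w))).
    by apply: eq_Rintegral => w _; rewrite indicE in_setT mul1r.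
  by rewrite mk; apply: eq_Rintegral => w _; rewrite indicE in_setT mul1r.
rewrite E -expectB.
- by apply: eq_Rintegral => w _; case: (X s w) => //=; rewrite subr0.
- apply: (@bounded_extend0 _ _ _ _ _ _ hX _ _ M) => //.
    exact: (semigroup_measurable hX t0 mu uM).
  move=> z _; apply: expect_norm_le; first exact: (measurable_extend0 hX).
  by move=> w; apply: (norm_extend0_le hX).
- exact: (@bounded_extend0 _ _ _ _ _ _ hX _ _ M).
Qed.

Lemma generator_bound (u : R -> R) : C2c (interior I) u ->
  exists2 M, 0 <= M & forall t y, 0 <= t -> I y ->
    `|semigroup P X t u y - u y| <= M * t.
Proof.
move=> Cu; have [mu _] := C2c_bounded Cu; have [_ _ _ [M HM]] := hG Cu.
exists `|M| => // t y t0 Iy; have [->|tN0] := eqVneq t 0.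
  by rewrite semigroup_start// subrr normr0 mulr0.
have tp : 0 < t by rewrite lt_neqAle eq_sym tN0.
rewrite -ler_pdivrMr//; have := HM t y tp Iy.
by rewrite normrM normfV (ger0_norm t0) => /le_trans -> //; exact: ler_norm.
Qed.

Lemma semigroup_lipschitz (u : R -> R) : C2c (interior I) u ->
  exists2 M, 0 <= M & forall y s t, I y -> 0 <= s -> s <= t ->
    `|semigroup P X t u y - semigroup P X s u y| <= M * (t - s).
Proof.
move=> Cu; have [mu [N uN]] := C2c_bounded Cu; have [M M0 HM] := generator_bound Cu.
have N0 : 0 <= N := le_trans (normr_ge0 _) (uN 0).
exists M => // y s t Iy s0 st; have ts0 : 0 <= t - s by rewrite subr_ge0.
rewrite -{1}[t](subrKC s) semigroup_increment//; apply: expect_norm_le.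
  apply: (measurable_extend0 hX) => //; apply: measurable_funB.
    exact: (semigroup_measurable hX ts0 mu uN).
  by apply: measurable_funS mu.
move=> w; apply: (norm_extend0_le hX) => //; last exact: mulr_ge0.
by move=> z Iz; exact: HM.
Qed.

(** Markov property at time [s], then bounded convergence of the difference
quotients of the generator.  Convergence along a sequence is all that
[dini_increment_le] requires. *)
Lemma semigroup_right_derivative (u : R -> R) (y s : R) :
  C2c (interior I) u -> I y -> 0 <= s ->
  ((semigroup P X (s + n.+1%:R^-1) u y - semigroup P X s u y) / n.+1%:R^-1)
     @[n --> \oo] --> \int[P y]_w extend0 (diff_op a b u) (X s w).
Proof.
move=> Cu Iy s0; have [mu [N uN]] := C2c_bounded Cu.
have [_ _ cG [M HM]] := hG Cu.
have M0 : 0 <= M := le_trans (normr_ge0 _) (HM _ _ ltr01 Iy).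
pose q n z := (semigroup P X n.+1%:R^-1 u z - u z) / n.+1%:R^-1.
have dn0 n : (0 : R) <= n.+1%:R^-1 by rewrite invr_ge0.
have dn n : (0 : R) < n.+1%:R^-1 by rewrite invr_gt0.
have mdiff n : measurable_fun I (fun z => semigroup P X n.+1%:R^-1 u z - u z).
  apply: measurable_funB; first exact: (semigroup_measurable hX (dn0 n) mu uN).
  by apply: measurable_funS mu.
have mq n : measurable_fun I (q n) by apply: measurable_funM.
have -> : (fun n =>
    (semigroup P X (s + n.+1%:R^-1) u y - semigroup P X s u y) / n.+1%:R^-1)
    = fun n => \int[P y]_w extend0 (q n) (X s w).
  apply/funext => n; rewrite semigroup_increment// mulrC -expectZ.
    apply: eq_Rintegral => w _; case: (X s w) => [z|] /=; last by rewrite mulr0.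
    by rewrite /q mulrC.
  apply: (@bounded_extend0 _ _ _ _ _ _ hX _ _ (M * n.+1%:R^-1)) => //.
    move=> z Iz; have := HM _ z (dn n) Iz.
    by rewrite normrM normfV (ger0_norm (dn0 n)) ler_pdivrMr.
  exact: mulr_ge0.
apply: (@expect_bounded_cvg _ _ _ _ _ _ M) => [n|n w|w].
- exact: (measurable_extend0 hX).
- by apply: (norm_extend0_le hX) => // z Iz; exact: HM.
case E : (X s w) => [z|] /=; last exact: cvg_cst.
have Iz := diffusion_state hX s0 E.
move: (cG z Iz) => /cvg_at_rightP; apply; split=> //; exact: cvg_harmonic.
Qed.

(** If [|Gu - c| <= e] near [(l, r)] then [P_t u = u + c t] up to [e t + O(t^2)],
uniformly on [(l, r)].  The derivative of [s |-> P_s u(y)] is [E_y[Gu(X_s)]], so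
only the probability that [X_s] has left the neighbourhood matters; the cutoff
[v] bounds it by [v(y) - P_s v(y) = O(s)]. *)
Lemma semigroup_local_expansion (u v : R -> R) (c e l r : R) :
  C2c (interior I) u -> C2c (interior I) v -> 0 <= e ->
  (forall z, 0 <= v z <= 1) -> (forall z, l < z < r -> I z /\ v z = 1) ->
  (forall z, I z -> v z != 0 -> `|diff_op a b u z - c| <= e) ->
  exists2 C, 0 <= C & forall y t, l < y < r -> 0 <= t ->
    `|semigroup P X t u y - u y - c * t| <= (e + C * t) * t.
Proof.
move=> Cu Cv e0 v01 v1 gc.
have [mu [N uN]] := C2c_bounded Cu; have [mv [N' vN]] := C2c_bounded Cv.
have [Mv Mv0 HMv] := generator_bound Cv.
have [M M0 HM] := semigroup_lipschitz Cu.
have [_ [_ [G gG]] _ _] := hG Cu.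
pose C' := `|G| + `|c|; have C'0 : 0 <= C' by rewrite addr_ge0.
exists (C' * Mv); first exact: mulr_ge0.
move=> y t yl t0; have [Iy vy] := v1 y yl.
have mg := generator_measurable Cu.
have bg s : 0 <= s -> bounded_rv (fun w => extend0 (diff_op a b u) (X s w)).
  move=> s0; apply: (@bounded_extend0 _ _ _ _ _ _ hX _ _ `|G|) => // z Iz.
  exact: le_trans (gG z Iz) (ler_norm _).
have bv s : 0 <= s -> bounded_rv (fun w => extend0 v (X s w)).
  move=> s0; apply: (@bounded_extend0 _ _ _ _ _ _ hX _ _ N') => //.
    by apply: measurable_funS mv.
  exact: le_trans (normr_ge0 _) (vN 0).
(* the right derivative of s |-> P_s u(y) stays close to c *)
have D s : 0 <= s -> s <= t ->
    `|\int[P y]_w extend0 (diff_op a b u) (X s w) - c| <= e + C' * Mv * t.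
  move=> s0 st; rewrite -[X in _ - X](expect_cst (P y) c) -expectB;
    [|exact: bg|exact: bounded_rv_cst].
  have bZ : bounded_rv (fun w => extend0 (diff_op a b u) (X s w) - c).
    by apply: bounded_rvB; [exact: bg | exact: bounded_rv_cst].
  apply: (le_trans (le_normr_Rintegral _ _)) => //; first exact: bounded_rv_integrable.
  apply: (@le_trans _ _ (\int[P y]_w (e + C' * (1 - extend0 v (X s w))))).
    apply: expect_le.
    - have [mZ [B ZB]] := bZ; split; first exact: measurableT_comp.
      by exists B => w; rewrite normr_id.
    - apply: bounded_rvD; first exact: bounded_rv_cst.
      by apply/bounded_rvZ/bounded_rvB; [exact: bounded_rv_cst | exact: bv].
    move=> w; case E : (X s w) => [z|] /=; last first.
      by rewrite sub0r normrN subr0 mulr1 /C' addrA lerDr addr_ge0.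
    have Iz := diffusion_state hX s0 E; have /andP[vz0 vz1] := v01 z.
    have [vz|vz] := eqVneq (v z) 0.
      rewrite vz subr0 mulr1 /C'; have := gG z Iz; have := ler_norm G.
      have := ler_normB (diff_op a b u z) c; lra.
    by rewrite (le_trans (gc z Iz vz))// lerDl mulr_ge0// subr_ge0.
  rewrite expectD; [|exact: bounded_rv_cst|]; last first.
    by apply/bounded_rvZ/bounded_rvB; [exact: bounded_rv_cst | exact: bv].
  rewrite expectZ; last by apply/bounded_rvB; [exact: bounded_rv_cst | exact: bv].
  rewrite expectB; [|exact: bounded_rv_cst|exact: bv].
  rewrite !expect_cst lerD2l -mulrA ler_wpM2l//.
  have := HMv s y s0 Iy; rewrite vy ler_norml => /andP[H _].
  have : Mv * s <= Mv * t by rewrite ler_wpM2l.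
  by move: H; rewrite /semigroup /extend0; lra.
have dini s e' d' : 0 <= s -> s < t -> 0 < e' -> 0 < d' ->
    exists2 h, 0 < h < d' &
     `|semigroup P X (s + h) u y - semigroup P X s u y - c * h|
       <= (e + C' * Mv * t + e') * h.
  move=> s0 st e'0 d'0.
  pose D0 := \int[P y]_w extend0 (diff_op a b u) (X s w).
  pose q (n : nat) := (semigroup P X (s + n.+1%:R^-1) u y - semigroup P X s u y) /
    n.+1%:R^-1.
  have H1 : \forall n \near \oo, `|D0 - q n| <= e'.
    have /cvgrPdist_le := semigroup_right_derivative Cu Iy s0; exact.
  have H2 : \forall n \near \oo, `|0 - (harmonic n : R)| < d'.
    have /cvgrPdist_lt := @cvg_harmonic R; exact.
  near \oo => n; exists n.+1%:R^-1.
    have : `|0 - (harmonic n : R)| < d' by near: n.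
    by rewrite sub0r normrN ger0_norm /harmonic/= ?invr_ge0// invr_gt0 ltr0n => ->.
  have hn : 0 < (n.+1%:R^-1 : R) by rewrite invr_gt0.
  rewrite -ler_pdivrMr// -[X in _ / X]gtr0_norm// -normf_div mulrBl mulfK ?gt_eqF//.
  rewrite -/(q n); have D1 : `|D0 - c| <= _ := D _ s0 (ltW st).
  have Dq : `|D0 - q n| <= e' by near: n.
  have := ler_distD D0 (q n) c; rewrite (distrC (q n) D0); lra.
have St := semigroup_start Iy mu.
rewrite ler_norml; apply/andP; split.
- have := @dini_increment_le _ (fun s => - semigroup P X s u y) M
      (- c + (e + C' * Mv * t)) t t0.
  rewrite St => H.
  suff : - semigroup P X t u y - - u y <= (- c + (e + C' * Mv * t)) * t by lra.
  apply: H => [s s' s0 ss'|s e' d' s0 st e'0 d'0].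
    by rewrite -opprB normrN opprK addrC; exact: HM.
  have [h hd] := dini s e' d' s0 st e'0 d'0.
  by rewrite ler_norml => /andP[H _]; exists h => //; lra.
- have := @dini_increment_le _ (fun s => semigroup P X s u y) M
      (c + (e + C' * Mv * t)) t t0.
  rewrite St => H.
  suff : semigroup P X t u y - u y <= (c + (e + C' * Mv * t)) * t by lra.
  apply: H => [s s' s0 ss'|s e' d' s0 st e'0 d'0]; first exact: HM.
  have [h hd] := dini s e' d' s0 st e'0 d'0.
  by rewrite ler_norml => /andP[_ H]; exists h => //; lra.
Unshelve. all: by end_near. Qed.

End generator.

(** * Staying in an interval, and the exit time *)

Lemma g_sigma_bigcap (T : Type) (G : set (set T)) (A : nat -> set T) :
  (forall i, <<s G >> (A i)) -> <<s G >> (\bigcap_i A i).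
Proof.
move=> GA; rewrite -[X in <<s G >> X]setCK setC_bigcap -setTD.
apply: sigma_algebraCD; apply: sigma_algebra_bigcup => i.
by rewrite -setTD; apply: sigma_algebraCD.
Qed.

(** The minimum keeps the index [i], which ranges over all natural numbers, within
the grid of mesh [1 / (n + 1)]; every grid contains the point [1], whose role is
to detect death before the end of a time interval. *)
Lemma unit_grid_dense (R : realType) (x e : R) : 0 <= x <= 1 -> 0 < e ->
  exists n i : nat, `|x - (minn i n.+1)%:R / n.+1%:R| < e.
Proof.
move=> /andP[x0 x1] e0.
have [n ne] : exists n : nat, n.+1%:R^-1 < e.
  have /cvgrPdist_lt /(_ _ e0) [N _ HN] := @cvg_harmonic R.
  by exists N; have := HN N (leqnn N); rewrite /= sub0r normrN ger0_norm ?invr_ge0.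
exists n, (Num.truncn (x * n.+1%:R)).
have n0 : 0 < n.+1%:R :> R by rewrite ltr0n.
have /andP[i1 i2] := truncn_itv (mulr_ge0 x0 (ltW n0)).
set i := Num.truncn _ in i1 i2 *.
have iN : (i <= n.+1)%N.
  by rewrite -(ler_nat R) (le_trans i1)// ler_piMl// ltW.
rewrite (minn_idPl iN); apply: le_lt_trans ne.
have -> : x - i%:R / n.+1%:R = (x * n.+1%:R - i%:R) / n.+1%:R by field.
rewrite normrM ger0_norm ?subr_ge0// gtr0_norm ?invr_gt0//.
rewrite -[X in _ <= X]mul1r ler_wpM2r ?invr_ge0 ?(ltW n0)//.
by move: i2; rewrite -natr1; lra.
Qed.

Section exit.
Context (d : measure_display) (Omega : measurableType d) (R : realType).
Context (I : set R) (P : R -> probability Omega R).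
Context (X : R -> Omega -> option R) (hX : regular_diffusion I P X).

Definition stays (l r u t : R) : set Omega :=
  [set w | forall s, u <= s <= t -> state_in X s [set y | l < y < r] w].

Lemma stays_le (l r u s t : R) : s <= t -> stays l r u t `<=` stays l r u s.
Proof.
by move=> st w wt q /andP[uq qs]; apply: wt; rewrite uq (le_trans qs st).
Qed.

Lemma indic_stays_le (l r u s t : R) (w : Omega) : s <= t ->
  (\1_(stays l r u t) w : R) <= \1_(stays l r u s) w.
Proof.
move=> st; have [H|H] := pselect (stays l r u t w).
  by rewrite !indicE !mem_set//; exact: stays_le H.
by rewrite [leLHS]indicE memNset.
Qed.

(* The path, frozen at its initial value on the negative times, so that it is
   continuous at time 0 from both sides. *)
Let path (w : Omega) (s : R) : R := odflt 0 (X (Num.max s 0) w).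

Let path_continuous (w : Omega) (s y : R) : 0 <= s -> X s w = Some y ->
  {for s, continuous (path w)}.
Proof.
move=> s0 sy; apply/cvgrPdist_lt => e e0.
have maxc : Num.max q 0 @[q --> s] --> s.
  rewrite -[X in _ --> X](max_l s0).
  by apply: continuous_max; [exact: cvg_id | exact: cvg_cst].
have H := maxc _ (diffusion_continuous hX s0 sy e0).
near=> q; rewrite /path (max_l s0) sy.
have [|z -> /=] : 0 <= Num.max q 0 ->
    exists2 z, X (Num.max q 0) w = Some z & `|z - y| < e by near: q; exact: H.
  by rewrite le_max lexx orbT.
by rewrite distrC.
Unshelve. all: by end_near. Qed.

(** By compactness the path stays at a positive distance of the end-points;
conversely a closed condition passes from a dense set of times to all times. *)
Lemma staysE (l r u t : R) : 0 <= u -> u <= t ->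
  stays l r u t = \bigcup_m \bigcap_n \bigcap_i
    state_in X (u + (t - u) * ((minn i n.+1)%:R / n.+1%:R))
      `[l + m.+1%:R^-1, r - m.+1%:R^-1].
Proof.
move=> u0 ut.
have tu0 : 0 <= t - u by rewrite subr_ge0.
have grid n i : u <= u + (t - u) * ((minn i n.+1)%:R / n.+1%:R) <= t.
  have H1 : (minn i n.+1)%:R / n.+1%:R <= 1 :> R.
    by rewrite ler_pdivrMr// mul1r ler_nat geq_minr.
  have H0 : 0 <= (minn i n.+1)%:R / n.+1%:R :> R by rewrite divr_ge0.
  by rewrite lerDl mulr_ge0//= -lerBrDl ler_piMr.
apply/seteqP; split=> w.
  move=> sw.
  have alive s : u <= s <= t ->
      exists y, [/\ X s w = Some y, path w s = y & l < y < r].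
    move=> us; have [y lyr sy] := sw s us.
    exists y; split=> //; rewrite /path max_l -?sy//.
    by case/andP: us => us _; exact: le_trans us.
  have cp : {within `[u, t], continuous (path w)}.
    apply: continuous_in_subspaceT => s; rewrite inE /= in_itv /= => us.
    have [y [sy _ _]] := alive s us.
    by apply: (path_continuous _ sy); case/andP: us => us _; exact: le_trans us.
  have [c1 c1ut c1max] := EVT_max ut cp; have [c2 c2ut c2min] := EVT_min ut cp.
  rewrite !in_itv /= in c1ut c2ut.
  have [y1 [_ p1 /andP[_ y1r]]] := alive _ c1ut.
  have [y2 [_ p2 /andP[ly2 _]]] := alive _ c2ut.
  have e0 : 0 < Num.min (r - y1) (y2 - l) by rewrite lt_min !subr_gt0 y1r.
  have /cvgrPdist_lt /(_ _ e0) [m _ /(_ m (leqnn m))] := @cvg_harmonic R.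
  rewrite /= sub0r normrN ger0_norm ?invr_ge0// lt_min => /andP[m1 m2].
  exists m => // n _ i _; have := grid n i; set q := _ + _ => uq.
  have [y [sy py _]] := alive _ uq.
  exists y; last by rewrite sy.
  have := c1max q; have := c2min q; rewrite !in_itv /= py p1 p2 => /(_ uq) h2 /(_ uq) h1.
  rewrite /= in_itv /=; set k : R := m.+1%:R^-1 in m1 m2 *.
  by apply/andP; split; lra.
move=> [m _].
have : (0 : R) < m.+1%:R^-1 by rewrite invr_gt0.
move: (m.+1%:R^-1 : R) => k k0 Hm s us.
have q1 : X (u + (t - u) * ((minn 1 1)%:R / 1%:R)) w <> None.
  by have [y _ <-] := Hm 0%N Logic.I 1%N Logic.I.
have s0 : 0 <= s by case/andP: us => us _; exact: le_trans us.
case sy : (X s w) => [y|]; last first.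
  case: q1; apply: (diffusion_cemetery hX s0 _ sy).
  rewrite minnn divff// mulr1; case/andP: us; lra.
exists y => //=.
have main : l + k <= y <= r - k; last first.
  by case/andP: main => ? ?; apply/andP; split; lra.
rewrite -[_ && _]negbK; apply/negP => ny.
pose e := Num.max (l + k - y) (y - (r - k)).
have e0 : 0 < e.
  by rewrite lt_max !subr_gt0 !ltNge -negb_and.
have /nbhs_ballP [q /= q0 Hq] := diffusion_continuous hX s0 sy e0.
have [x x01 sE] : exists2 x, 0 <= x <= 1 & s = u + (t - u) * x.
  have [tu|tu] := eqVneq t u.
    exists 0; first by rewrite lexx ler01.
    by rewrite mulr0 addr0; case/andP: us; rewrite tu => ? ?; apply/le_anti/andP.
  have tup : 0 < t - u by rewrite subr_gt0 lt_neqAle eq_sym tu.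
  exists ((s - u) / (t - u)); last by field; rewrite gt_eqF.
  by rewrite divr_ge0 ?ler_pdivrMr//; case/andP: us; lra.
have p0 : 0 < q / (t - u + 1) by rewrite divr_gt0//; lra.
have [n [i ni]] := unit_grid_dense x01 p0.
have [|| z Xz zy] := Hq (u + (t - u) * ((minn i n.+1)%:R / n.+1%:R)).
- rewrite /ball /= sE opprD addrACA subrr add0r -mulrBr normrM (ger0_norm tu0).
  have tu1 : 0 < t - u + 1 by lra.
  rewrite ltr_pdivlMr// in ni; apply: le_lt_trans ni.
  by rewrite mulrC ler_wpM2l//; lra.
- by case/andP: (grid n i) => + _; exact: le_trans.
have [z' /= + Xz'] := Hm n Logic.I i Logic.I; rewrite Xz in Xz'; case: Xz' => ->.
rewrite in_itv /= => /andP[z1 z2].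
move: zy; rewrite /e lt_max; case/orP => H.
  by have := ler_norm (z - y); lra.
by have := ler_norm (y - z); rewrite distrC; lra.
Qed.

Lemma stays_history (l r u t : R) : 0 <= u -> u <= t ->
  history X t (stays l r u t).
Proof.
move=> u0 ut; rewrite staysE//; apply: sigma_algebra_bigcup => m.
apply: g_sigma_bigcap => n; apply: g_sigma_bigcap => i.
apply: sub_sigma_algebra.
exists (u + (t - u) * ((minn i n.+1)%:R / n.+1%:R)),
  [set` `[l + m.+1%:R^-1, r - m.+1%:R^-1]]; split=> //.
have H1 : (minn i n.+1)%:R / n.+1%:R <= 1 :> R.
  by rewrite ler_pdivrMr// mul1r ler_nat geq_minr.
have H0 : 0 <= (minn i n.+1)%:R / n.+1%:R :> R by rewrite divr_ge0.
have tu0 : 0 <= t - u by rewrite subr_ge0.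
by rewrite /= addr_ge0 ?mulr_ge0//= -lerBrDl ler_piMr.
Qed.

Lemma stays_measurable (l r u t : R) : 0 <= u -> measurable (stays l r u t).
Proof.
move=> u0; have [ut|tu] := leP u t.
  exact: (history_measurable hX (stays_history l r u0 ut)).
rewrite (_ : stays _ _ _ _ = setT)//; apply/seteqP; split=> // w _ s.
by move=> /andP[us st]; have := le_trans us st; rewrite leNgt tu.
Qed.

(** The paths are observed on [[1/n, t - 1/n]] because neither the state at time
[0] nor the state at time [t] matters for [t <= tau]. *)
Lemma exit_time_measurable (l r : R) : measurable_fun setT (exit_time X l r).
Proof.
apply: (measurability _ (ErealGenCInfty.measurableE R)) => // _ [_ [t ->] <-].
rewrite setTI (_ : _ @^-1` _ =
    \bigcap_(n : nat) stays l r n.+1%:R^-1 (t - n.+1%:R^-1)).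
  by apply: bigcapT_measurable => n; apply: stays_measurable; rewrite invr_ge0.
apply/seteqP; split=> w /=.
  rewrite in_itv /= andbT => tw n _ s /andP[ns st].
  have n0 : (0 : R) < n.+1%:R^-1 by rewrite invr_gt0.
  apply: contrapT => bad; have : (exit_time X l r w <= s%:E)%E.
    apply: ereal_inf_lbound; exists s => //; split=> //.
    exact: lt_le_trans ns.
  move=> /(le_trans tw); rewrite lee_fin => ts.
  by have := le_trans ts st; rewrite lerBrDr gerDl leNgt n0.
move=> H; rewrite in_itv /= andbT; apply: le_ereal_inf_tmp => _ [s [s0 bad] <-].
rewrite lee_fin leNgt; apply/negP => st; apply: bad.
have e0 : 0 < Num.min s (t - s) by rewrite lt_min s0 subr_gt0.
have /cvgrPdist_lt /(_ _ e0) [n _ /(_ n (leqnn n))] := @cvg_harmonic R.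
rewrite /= sub0r normrN ger0_norm ?invr_ge0// lt_min => /andP[m1 m2].
by apply: (H n Logic.I s); rewrite (ltW m1) lerBrDr -lerBrDl ltW.
Qed.

Lemma exit_time_ge0 (l r : R) (w : Omega) : (0 <= exit_time X l r w)%E.
Proof.
by apply: le_ereal_inf_tmp => _ [s [s0 _] <-]; rewrite lee_fin ltW.
Qed.

Lemma stays_exit_time (l r t : R) (w : Omega) : stays l r 0 t w ->
  (t%:E <= exit_time X l r w)%E.
Proof.
move=> st; apply: le_ereal_inf_tmp => _ [s [s0 bad] <-].
rewrite lee_fin leNgt; apply/negP => /ltW st'; apply: bad; apply: st.
by rewrite (ltW s0).
Qed.

Lemma not_stays_exit_time (l r t : R) (w : Omega) :
  state_in X 0 [set y | l < y < r] w -> ~ stays l r 0 t w ->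
  (exit_time X l r w <= t%:E)%E.
Proof.
move=> w0 /existsNP [s /not_implyP [/andP[s0 st] bad]].
apply: (@le_trans _ _ s%:E); last by rewrite lee_fin.
apply: ereal_inf_lbound; exists s => //; split=> //.
rewrite lt_neqAle s0 andbT; apply/negP => /eqP s0'.
by apply: bad; rewrite -s0'.
Qed.

(** Right after its first exit from [(l, r)], which happens at the boundary or
by death, a path is outside any [(l', r')] with [l < l'] and [r' < r]. *)
Lemma no_fast_return (l r l' r' : R) (w : Omega) : l < l' -> r' < r ->
  exists2 e, 0 < e & forall s t, 0 <= s -> t < s + e ->
    stays l r 0 s w -> ~ stays l r 0 t w ->
    ~ state_in X t [set y | l' < y < r'] w.
Proof.
move=> ll rr.
pose S := [set s : R | 0 <= s /\ ~ state_in X s [set y | l < y < r] w].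
have [S0|/set0P S0] := eqVneq S set0.
  exists 1 => // s t _ _ _; case=> q /andP[q0 _].
  by apply: contrapT => bad; have : S q by []; rewrite S0.
have lbS : lbound S 0 by move=> s [].
have infS : has_inf S by split=> //; exists 0.
pose s1 := inf S.
have s10 : 0 <= s1 by apply: lb_le_inf.
have lbs1 s : S s -> s1 <= s by move=> Ss; apply: ge_inf => //; exists 0.
have nbd y e : X s1 w = Some y -> 0 < e -> exists2 q, 0 < q &
    forall s, s1 <= s < s1 + q -> exists2 z, X s w = Some z & `|z - y| < e.
  move=> sy e0; have /nbhs_ballP [q /= q0 Hq] := diffusion_continuous hX s10 sy e0.
  exists q => // s /andP[ss sq]; apply: Hq; last exact: le_trans ss.
  by rewrite /ball /= distrC ger0_norm; lra.
(* by continuity the infimum of the exit times is itself an exit time *)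
have Ss1 : S s1.
  split=> // -[y /= lyr sy].
  have e0 : 0 < Num.min (y - l) (r - y) by rewrite lt_min !subr_gt0.
  have [q q0 Hq] := nbd y _ (esym sy) e0.
  have [s Ss ss] := inf_adherent q0 infS.
  have [|z sz] := Hq s; first by rewrite lbs1.
  rewrite lt_min !ltr_norml => /andP[/andP[z1 _] /andP[_ z2]].
  case: Ss => _; apply; exists z => //=; apply/andP; split; lra.
have [e e0 He] : exists2 e, 0 < e & forall t, s1 <= t < s1 + e ->
    ~ state_in X t [set y | l' < y < r'] w.
  case sy : (X s1 w) => [y|]; last first.
    exists 1 => // t /andP[st _] [z _].
    by rewrite (diffusion_cemetery hX s10 st sy).
  have e0 : 0 < Num.min (l' - l) (r - r') by rewrite lt_min !subr_gt0 ll.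
  have [q q0 Hq] := nbd y _ sy e0.
  exists q => // t /Hq [z tz zy] [z' /= zz' Xz']; rewrite tz in Xz'.
  case: Xz' => E; rewrite {}E in zz'.
  case: Ss1 => _; apply; exists y => //=.
  move: zy; rewrite lt_min !ltr_norml => /andP[/andP[_ z1] /andP[z2 _]].
  case/andP: zz' => z3 z4; apply/andP; split; lra.
exists e => // s t s0 te ws wt; apply: He; apply/andP; split.
  move: wt => /existsNP [q /not_implyP [/andP[q0 qt] bad]].
  by apply: le_trans qt; apply: lbs1.
suff : s < s1 by lra.
rewrite ltNge; apply/negP => s1s.
by case: Ss1 => _; apply; apply: ws; rewrite s10.
Qed.

End exit.

(** * Mean exit time and discrete occupation sums *)

Lemma summation_by_parts (R : comPzRingType) (b u : nat -> R) (N : nat) :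
  \sum_(0 <= k < N) b k * (u k.+1 - u k) =
  b N * u N - b 0%N * u 0%N + \sum_(0 <= k < N) (b k - b k.+1) * u k.+1.
Proof.
elim: N => [|N IH]; first by rewrite !big_geq// subrr addr0.
by rewrite !big_nat_recr//= IH; ring.
Qed.

Section mean_exit.
Context (d : measure_display) (Omega : measurableType d) (R : realType).
Context (I : set R) (P : R -> probability Omega R).
Context (X : R -> Omega -> option R) (hX : regular_diffusion I P X).
Variables (l r x : R).
Hypotheses (Ix : I x) (lxr : l < x < r).

Local Notation B := (stays X l r 0).

Definition stay_prob (t : R) : R := \int[P x]_w \1_(B t) w.
Local Notation p := stay_prob.

Let mB (t : R) : measurable (B t). Proof. exact: (stays_measurable hX). Qed.

Let bB (t : R) : bounded_rv (\1_(B t) : Omega -> R).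
Proof. exact: bounded_rv_indic. Qed.

Let pE (t c : R) : (\int[P x]_w (c * \1_(B t) w)%:E = (c * p t)%:E)%E.
Proof.
rewrite -expectZ// /Rintegral fineK//; apply: integrable_fin_num => //.
exact/bounded_rv_integrable/bounded_rvZ.
Qed.

(** The number of grid times before the exit, times the step [t], is the exit time
rounded up to the grid; this lemma and the next one take expectations. *)
Lemma mean_exit_time_le_sum (t L : R) : 0 < t ->
  (forall N, \sum_(0 <= k < N) t * p (k%:R * t) <= L) ->
  (mean_exit_time P X x l r <= L%:E)%E.
Proof.
move=> t0 HL; rewrite /mean_exit_time.
have mt k : measurable_fun setT (fun w => (t * \1_(B (k%:R * t)) w)%:E).
  by apply/measurable_EFinP; exact: (bounded_rvZ t (bB _)).1.
have t1 k w : (0 <= (t * \1_(B (k%:R * t)) w)%:E)%E.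
  by rewrite lee_fin mulr_ge0 ?(ltW t0).
apply: (@le_trans _ _ (\int[P x]_w
    (\sum_(0 <= k <oo) (t * \1_(B (k%:R * t)) w)%:E)))%E.
  apply: ae_ge0_le_integral => //.
  - by move=> w _; exact: exit_time_ge0.
  - exact: (exit_time_measurable hX).
  - by move=> w _; apply: nneseries_ge0.
  - by apply: ge0_emeasurable_sum.
  exists (~` state_in X 0 [set x]).
  have mD : measurable (state_in X 0 [set x]) by exact: (diffusion_measurable hX).
  split; first exact: measurableC.
    by rewrite [LHS]probability_setC// (diffusion_start hX Ix) subee.
  move=> w /=; apply: contra_not => -[_ /= -> X0] _.
  have w0 : state_in X 0 [set y | l < y < r] w by exists x.
  set S := (\sum_(_ <= _ <oo) _)%E.
  have SN N : (\sum_(0 <= k < N) (t * \1_(B (k%:R * t)) w)%:E <= S)%E.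
    exact: nneseries_lim_ge.
  have S_all N : (forall k, (k < N)%N -> B (k%:R * t) w) -> ((N%:R * t)%:E <= S)%E.
    move=> BN; apply: le_trans (SN N).
    rewrite sumEFin lee_fin (eq_big_nat _ _ (F2 := fun=> t)).
      by rewrite sumr_const_nat subn0 mulr_natl.
    by move=> k kN; rewrite indicE mem_set ?mulr1//; exact: BN.
  have [BT|/existsNP [N0 BN0]] := pselect (forall k, B (k%:R * t) w).
    suff -> : S = +oo%E by rewrite leey.
    apply/eqyP => A A0; have [N NA] : exists N : nat, A / t <= N%:R.
      by exists (Num.truncn (A / t)).+1; rewrite ltW// truncnS_gt// num_real.
    by apply: le_trans (S_all N _) => //; rewrite lee_fin -ler_pdivrMr.
  have [N /asboolP BN Nmin] := @ex_minnP (fun k => `[< ~ B (k%:R * t) w >])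
    (ex_intro _ N0 (introT (asboolP _) BN0)).
  apply: (le_trans (not_stays_exit_time w0 BN)); apply: S_all => k kN.
  apply: contrapT => nB; have /Nmin : `[< ~ B (k%:R * t) w >] by apply/asboolP.
  by rewrite leqNgt kN.
rewrite integral_nneseries//; apply: lime_le.
  by apply: is_cvg_nneseries => k _ _; exact: integral_ge0.
apply: nearW => N; under eq_bigr do rewrite pE.
by rewrite sumEFin lee_fin.
Qed.

Lemma sum_le_mean_exit_time (t : R) (N : nat) : 0 < t ->
  ((\sum_(0 <= k < N) t * p (k%:R * t))%:E <= mean_exit_time P X x l r + t%:E)%E.
Proof.
move=> t0.
have bt k : bounded_rv (fun w => t * \1_(B (k%:R * t)) w) by exact: bounded_rvZ.
pose Z w := \sum_(0 <= k < N) t * \1_(B (k%:R * t)) w.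
have bZ : bounded_rv Z by exact: bounded_rv_sum.
have Z0 w : 0 <= Z w by apply: sumr_ge0 => k _; rewrite mulr_ge0 ?(ltW t0).
have -> : ((\sum_(0 <= k < N) t * p (k%:R * t))%:E = \int[P x]_w (Z w)%:E)%E.
  rewrite -[RHS]fineK; last first.
    by apply: integrable_fin_num => //; exact: bounded_rv_integrable.
  congr EFin; rewrite -/(Rintegral _ _ _) expect_sum//.
  by apply: eq_bigr => k _; rewrite expectZ.
have -> : (t%:E = \int[P x]_(w in setT) (cst t%:E) w)%E.
  rewrite integral_cst// -[RHS]/(t%:E * P x setT)%E.
  by rewrite [X in (_ * X)%E](probability_setT (P x)) mule1.
rewrite /mean_exit_time -ge0_integralD//; last 3 first.
- by move=> w _; exact: exit_time_ge0.
- exact: (exit_time_measurable hX).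
- by move=> w _; rewrite lee_fin ltW.
apply: ge0_le_integral => //.
- by move=> w _; rewrite lee_fin.
- by apply/measurable_EFinP; exact: bZ.1.
- apply: emeasurable_funD; first exact: (exit_time_measurable hX).
  exact: measurable_cst.
move=> w _; rewrite /Z.
elim: N {Z bZ Z0} => [|N IH].
  by rewrite big_geq// adde_ge0 ?exit_time_ge0// lee_fin ltW.
have [BN|nBN] := pselect (B (N%:R * t) w); last first.
  by rewrite big_nat_recr//= indicE memNset// mulr0 addr0.
apply: (@le_trans _ _ (N%:R * t + t)%:E); last first.
  by rewrite EFinD leeD2r//; exact: stays_exit_time.
rewrite lee_fin big_nat_recr//=; apply: lerD.
  rewrite mulr_natl -[X in t *+ X]subn0 -sumr_const_nat.
  by apply: ler_sum => k _; rewrite ler_piMr ?(ltW t0)// indicE lern1 leq_b1.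
by rewrite ler_piMr ?(ltW t0)// indicE lern1 leq_b1.
Qed.

Lemma stay_prob_le_mean_exit_time (t : R) : 0 <= t ->
  ((t * p t)%:E <= mean_exit_time P X x l r)%E.
Proof.
move=> t0; rewrite -pE; apply: ge0_le_integral => //.
- by move=> w _; rewrite lee_fin mulr_ge0.
- by apply/measurable_EFinP; exact: (bounded_rvZ t (bB _)).1.
- exact: (exit_time_measurable hX).
move=> w _; have [Bt|nBt] := pselect (B t w).
  by rewrite indicE mem_set// mulr1; exact: stays_exit_time.
by rewrite indicE memNset// mulr0; exact: exit_time_ge0.
Qed.

End mean_exit.

(** * Bounds on the mean exit time *)

Section bounds.
Context (d : measure_display) (Omega : measurableType d) (R : realType).
Context (I : set R) (P : R -> probability Omega R).
Context (X : R -> Omega -> option R) (a b : R -> R).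
Context (hX : regular_diffusion I P X) (hG : associated_operator I P X a b).
Variables (l r x : R).
Hypothesis lxr : l < x < r.

Local Notation B := (stays X l r 0).
Local Notation p := (stay_prob P X l r x).

Let bB (t : R) : bounded_rv (\1_(B t) : Omega -> R).
Proof. exact/bounded_rv_indic/(stays_measurable hX). Qed.

(* The support of the cutoff v is the neighbourhood of [(l, r)] on which the image
   of the test function u by the generator is known. *)
Variables (u v : R -> R) (c e : R).
Hypotheses (Cu : C2c (interior I) u) (Cv : C2c (interior I) v) (e0 : 0 <= e).
Hypotheses (v01 : forall z, 0 <= v z <= 1).
Hypotheses (v1 : forall z, l < z < r -> I z /\ v z = 1).
Hypotheses (uc : forall z, I z -> v z != 0 -> `|diff_op a b u z - c| <= e).

Let Ix : I x. Proof. by have [] := v1 lxr. Qed.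

Let bu (s : R) : 0 <= s -> bounded_rv (fun w => extend0 u (X s w)).
Proof.
move=> s0; have [mu [M uM]] := C2c_bounded hG Cu.
apply: (@bounded_extend0 _ _ _ _ _ _ hX _ _ M) => //.
  by apply: measurable_funS mu.
exact: le_trans (normr_ge0 _) (uM 0).
Qed.

Let increment_expectation : exists2 C, 0 <= C & forall s t, 0 <= s -> 0 <= t ->
  `|\int[P x]_w (\1_(B s) w * (extend0 u (X (s + t) w) - extend0 u (X s w)))
    - c * (t * p s)| <= (e + C * t) * (t * p s).
Proof.
have [C C0 HC] := semigroup_local_expansion hX hG Cu Cv e0 v01 v1 uc.
exists C => // s t s0 t0; have [mu [M uM]] := C2c_bounded hG Cu.
have M0 : 0 <= M := le_trans (normr_ge0 _) (uM 0).
have hB : history X s (B s) by exact: (stays_history hX).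
have st0 := addr_ge0 s0 t0.
have bPu : bounded_rv (fun w => extend0 (semigroup P X t u) (X s w)).
  apply: (@bounded_extend0 _ _ _ _ _ _ hX _ _ M) => //.
    exact: (semigroup_measurable hX t0 mu uM).
  move=> z _; apply: expect_norm_le; first exact: (bu t0).1.
  by move=> w; apply: (norm_extend0_le hX).
have -> : \int[P x]_w (\1_(B s) w * (extend0 u (X (s + t) w) - extend0 u (X s w))) =
    \int[P x]_w (\1_(B s) w * extend0 (fun z => semigroup P X t u z - u z) (X s w)).
  transitivity (\int[P x]_w (\1_(B s) w * extend0 u (X (s + t) w)) -
      \int[P x]_w (\1_(B s) w * extend0 u (X s w))).
    rewrite -expectB; [|by apply: bounded_rvM => //; exact: bu..].
    by apply: eq_Rintegral => w _; rewrite mulrBr.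
  rewrite (markov_property hX Ix s0 t0 hB mu uM).
  rewrite -expectB; [|by apply: bounded_rvM => //; exact: bu..].
  apply: eq_Rintegral => w _; rewrite -mulrBr; congr (_ * _).
  by case: (X s w) => //=; rewrite subr0.
set Z := fun w => \1_(B s) w * extend0 (fun z => semigroup P X t u z - u z) (X s w).
have bZ : bounded_rv Z.
  have -> : Z = fun w => \1_(B s) w *
      (extend0 (semigroup P X t u) (X s w) - extend0 u (X s w)).
    by apply/funext => w; rewrite /Z; case: (X s w) => //=; rewrite subr0.
  by apply: bounded_rvM => //; apply: bounded_rvB => //; exact: bu.
have ZB w : `|Z w - c * t * \1_(B s) w| <= (e + C * t) * t * \1_(B s) w.
  have [Bw|nBw] := pselect (B s w); last first.
    by rewrite /Z indicE memNset// mul0r !mulr0 subrr normr0.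
  rewrite /Z indicE mem_set// !mulr1 mul1r.
  have [|z lzr <-] := Bw s; first by rewrite s0 lexx.
  by rewrite /= HC.
have q1 : c * (t * p s) = \int[P x]_w (c * t * \1_(B s) w).
  by rewrite expectZ// mulrA.
have q2 : (e + C * t) * (t * p s) = \int[P x]_w ((e + C * t) * t * \1_(B s) w).
  by rewrite expectZ// mulrA.
rewrite q1 q2 ler_norml; apply/andP; split.
  rewrite lerNl opprB -expectB//; last exact: bounded_rvZ.
  apply: expect_le; [by apply: bounded_rvB => //; exact: bounded_rvZ|exact: bounded_rvZ|].
  by move=> w; have := ZB w; rewrite distrC ler_norml => /andP[].
rewrite -expectB//; last exact: bounded_rvZ.
apply: expect_le; [by apply: bounded_rvB => //; exact: bounded_rvZ|exact: bounded_rvZ|].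
by move=> w; have := ZB w; rewrite ler_norml => /andP[].
Qed.

(* The discrete Dynkin formula on a grid of step t. *)
Let total_increment : exists2 C, 0 <= C & forall t N, 0 <= t ->
  `|\int[P x]_w (\sum_(0 <= k < N) \1_(B (k%:R * t)) w *
       (extend0 u (X (k.+1%:R * t) w) - extend0 u (X (k%:R * t) w)))
    - c * \sum_(0 <= k < N) t * p (k%:R * t)| <=
  (e + C * t) * \sum_(0 <= k < N) t * p (k%:R * t).
Proof.
have [C C0 HC] := increment_expectation; exists C => // t N t0.
have kt0 k : 0 <= k%:R * t by rewrite mulr_ge0.
rewrite expect_sum; last first.
  by move=> k; apply: bounded_rvM => //;
      apply: bounded_rvB; exact: bu.
rewrite !mulr_sumr -sumrB; apply: le_trans (ler_norm_sum _ _ _) _.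
apply: ler_sum => k _.
have -> : k.+1%:R * t = k%:R * t + t by rewrite -natr1 mulrDl mul1r.
exact: HC.
Qed.

Let expect_start : \int[P x]_w extend0 u (X 0 w) = u x.
Proof. exact: (semigroup_start hX Ix (C2c_bounded hG Cu).1). Qed.

(** A nonnegative [u] loses at most [u x] up to the exit, while it loses [- c] per
unit of time up to the error [e']. *)
Lemma mean_exit_time_upper (e' : R) : (forall y, 0 <= u y) ->
  e < e' -> c + e' < 0 ->
  (mean_exit_time P X x l r <= (u x / (- c - e'))%:E)%E.
Proof.
move=> u0 ee' ce'; have [C C0 HC] := total_increment.
pose t := (e' - e) / (C + 1).
have t0 : 0 < t by rewrite divr_gt0//; lra.
have Ct : e + C * t <= e'.
  have : (C + 1) * t = e' - e by rewrite /t; field; rewrite gt_eqF//; lra.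
  by rewrite mulrDl mul1r; lra.
apply: (mean_exit_time_le_sum hX Ix lxr t0) => N.
have kt0 k : 0 <= k%:R * t by rewrite mulr_ge0// ltW.
have := HC t N (ltW t0); set S := \sum_(0 <= k < N) t * p (k%:R * t).
have S0 : 0 <= S.
  by apply: sumr_ge0 => k _; rewrite mulr_ge0 ?(ltW t0)//; exact: Rintegral_ge0.
set Z := \int[P x]_w _ => HZ.
have Zge : - u x <= Z.
  rewrite -expect_start -mulN1r -expectZ; last exact: bu.
  apply: expect_le; first exact/bounded_rvZ/bu.
    by apply: bounded_rv_sum => k; apply: bounded_rvM => //;
      apply: bounded_rvB; exact: bu.
  move=> w; have eu0 s : 0 <= extend0 u (X s w) by case: (X s w) => //=.
  have b01 s : (0 : R) <= \1_(B s) w <= 1 by rewrite indicE ler0n lern1 leq_b1.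
  rewrite (summation_by_parts (fun k => \1_(B (k%:R * t)) w)
    (fun k => extend0 u (X (k%:R * t) w))).
  rewrite mul0r mulN1r.
  have h1 : 0 <= \1_(B (N%:R * t)) w * extend0 u (X (N%:R * t) w).
    by rewrite mulr_ge0.
  have h2 : \1_(B 0) w * extend0 u (X 0 w) <= extend0 u (X 0 w).
    by rewrite ler_piMl//; case/andP: (b01 0).
  have h3 : 0 <= \sum_(0 <= k < N) (\1_(B (k%:R * t)) w - \1_(B (k.+1%:R * t)) w) *
      extend0 u (X (k.+1%:R * t) w).
    apply: sumr_ge0 => k _; rewrite mulr_ge0// subr_ge0 indic_stays_le//.
    by rewrite ler_wpM2r ?(ltW t0)// ler_nat.
  lra.
have : (e + C * t) * S <= e' * S by rewrite ler_wpM2r.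
rewrite ler_pdivlMr; last by lra.
by move: HZ; rewrite ler_norml => /andP[_]; lra.
Qed.

Variables (l' r' K : R).
Hypotheses (ll' : l < l') (rr' : r' < r).
Hypotheses (uK : forall y, u y <= K) (uJ : forall y, ~ (l' < y < r') -> u y <= 0).
Hypothesis (uxK : u x = K) (K0 : 0 <= K).

Let J : set R := [set y | l' < y < r'].

(* The indicator of the event that a path exits during a time step but is back in
   J at the end of that step: at most one term of the sum is not zero. *)
Let comeback (t : R) (N : nat) (w : Omega) : R :=
  \sum_(0 <= k < N) (\1_(B (k%:R * t)) w - \1_(B (k.+1%:R * t)) w) *
     extend0 \1_J (X (k.+1%:R * t) w).

Let stays_decr (t : R) (k : nat) (w : Omega) : 0 <= t ->
  0 <= \1_(B (k%:R * t)) w - \1_(B (k.+1%:R * t)) w :> R.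
Proof.
by move=> t0; rewrite subr_ge0 indic_stays_le// ler_wpM2r// ler_nat.
Qed.

Let ext_J01 (s : R) (w : Omega) : (0 : R) <= extend0 \1_J (X s w) <= 1.
Proof.
by case: (X s w) => [y|] /=; rewrite ?lexx ?ler01// indicE ler0n lern1 leq_b1.
Qed.

Let return01 (t : R) (N : nat) (w : Omega) : 0 <= t -> 0 <= comeback t N w <= 1.
Proof.
move=> t0; apply/andP; split.
  apply: sumr_ge0 => k _; rewrite mulr_ge0 ?stays_decr//.
  by case/andP: (ext_J01 (k.+1%:R * t) w).
apply: (@le_trans _ _ (\sum_(0 <= k < N)
    (\1_(B (k%:R * t)) w - \1_(B (k.+1%:R * t)) w))).
  apply: ler_sum => k _; rewrite ler_piMr ?stays_decr//.
  by case/andP: (ext_J01 (k.+1%:R * t) w).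
have -> : \sum_(0 <= k < N) (\1_(B (k%:R * t)) w - \1_(B (k.+1%:R * t)) w : R) =
    \1_(B (0%:R * t)) w - \1_(B (N%:R * t)) w.
  elim: N => [|N IH]; first by rewrite big_geq// subrr.
  by rewrite big_nat_recr//= IH; ring.
by rewrite !indicE lerBlDr ler_wpDr// lern1 leq_b1.
Qed.

Let measurable_J : measurable J.
Proof. by rewrite (_ : J = [set` `]l', r'[]). Qed.

Let bounded_return (t : R) (N : nat) : 0 <= t -> bounded_rv (comeback t N).
Proof.
move=> t0; apply: bounded_rv_sum => k; apply: bounded_rvM.
  exact: bounded_rvB.
have kt0 : 0 <= k.+1%:R * t by rewrite mulr_ge0.
apply: (@bounded_extend0 _ _ _ _ _ _ hX _ _ 1) => // y _.
by rewrite indicE ger0_norm ?ler0n// lern1 leq_b1.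
Qed.

(* Pathwise the indicator vanishes as soon as the step is shorter than the time
   which the path takes to come back. *)
Let return_cvg0 (T : nat) :
  (\int[P x]_w comeback n.+1%:R^-1 (T * n.+1) w) @[n --> \oo] --> (0 : R).
Proof.
rewrite -[X in _ --> X](expect_cst (P x) 0).
have dn0 n : (0 : R) <= n.+1%:R^-1 by rewrite invr_ge0.
apply: (@expect_bounded_cvg _ _ _ _ _ _ 1) => [n|n w|w].
- exact: (bounded_return _ (dn0 n)).1.
- by have /andP[h0 h1] := return01 (T * n.+1) w (dn0 n); rewrite ger0_norm.
have [q q0 Hq] := no_fast_return hX w ll' rr'.
apply/cvgrPdist_le => e1 e10.
have H : \forall n \near \oo, `|0 - (harmonic n : R)| < q.
  have /cvgrPdist_lt := @cvg_harmonic R; exact.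
near=> n.
have nq : n.+1%:R^-1 < q.
  have : `|0 - (harmonic n : R)| < q by near: n.
  by rewrite /= sub0r normrN ger0_norm.
rewrite /comeback big1 ?subrr ?normr0 ?ltW// => k _.
set s := k%:R * _; set s' := k.+1%:R * _.
have ss' : s' = s + n.+1%:R^-1 by rewrite /s' -natr1 mulrDl mul1r.
have s0 : 0 <= s by rewrite mulr_ge0.
have [Bs|nBs] := pselect (B s w); last first.
  rewrite !indicE !memNset ?subrr ?mul0r// => Bs'; apply: nBs; apply: stays_le Bs'.
  by rewrite ss' lerDl.
have [Bs'|nBs'] := pselect (B s' w).
  by rewrite !indicE !mem_set// subrr mul0r.
have s'q : s' < s + q by rewrite ss' ltrD2l.
have := Hq s s' s0 s'q Bs nBs'; rewrite /state_in /=.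
case: (X s' w) => [y|] /= H'; last by rewrite mulr0.
by rewrite [\1_J _]indicE memNset ?mulr0// => Jy; apply: H'; exists y.
Unshelve. all: by end_near. Qed.

(** When the path exits and is not back in [J] one step later, [u] has lost all of
its initial value [K]; the two exceptional events, a late exit and a fast return,
cost at most [K] times their probabilities. *)
Lemma mean_exit_time_lower (e' m : R) : e < e' -> c <= 0 ->
  mean_exit_time P X x l r = m%:E -> K <= (e' - c) * m.
Proof.
move=> ee' c0 Em; have [C C0 HC] := total_increment.
have m0 : 0 <= m.
  by rewrite -lee_fin -Em; apply: integral_ge0 => w _; exact: exit_time_ge0.
apply/ler_addgt0Pr => z z0.
(* the three errors bounded by y below add up to at most D y = z *)
pose D := e' - c + 2 * K + 1.
have e00 := e0; have K00 := K0.
have D0 : 0 < D by rewrite /D; lra.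
pose y := z / D; have y0 : 0 < y by rewrite divr_gt0.
(* a horizon which the exit time exceeds with probability at most y *)
have [T pT] : exists T : nat, p T%:R <= y.
  pose T := (Num.truncn (m / y)).+1; exists T.
  have T0 : (0 : R) < T%:R by rewrite ltr0n.
  have : T%:R * p T%:R <= m.
    by rewrite -lee_fin -Em; exact: (stay_prob_le_mean_exit_time hX).
  rewrite mulrC -ler_pdivlMr// => /le_trans; apply.
  rewrite ler_pdivrMr// mulrC -ler_pdivrMr// ltW// truncnS_gt//; exact: num_real.
have H1 : \forall n \near \oo,
    `|0 - (harmonic n : R)| <= Num.min y ((e' - e) / (C + 1)).
  have /cvgrPdist_le := @cvg_harmonic R; apply.
  by rewrite lt_min y0 divr_gt0//; lra.
have H2 : \forall n \near \oo,
    `|0 - \int[P x]_w comeback n.+1%:R^-1 (T * n.+1) w| <= y.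
  by have /cvgrPdist_le := @return_cvg0 T; exact.
near \oo => n.
have ry : `|0 - \int[P x]_w comeback n.+1%:R^-1 (T * n.+1) w| <= y by near: n.
have : `|0 - (harmonic n : R)| <= Num.min y ((e' - e) / (C + 1)) by near: n.
rewrite /= sub0r normrN ger0_norm ?invr_ge0//.
have TE : (T * n.+1)%:R * n.+1%:R^-1 = T%:R :> R by rewrite natrM mulfK.
move: ry TE; have : (0 : R) < n.+1%:R^-1 by rewrite invr_gt0.
move: (T * n.+1)%N (n.+1%:R^-1 : R) => N t t0.
rewrite sub0r normrN => /(le_trans (ler_norm _)) ry NT.
rewrite le_min => /andP[ty tC].
have {tC}Ct : e + C * t <= e'.
  have : t * (C + 1) <= e' - e by rewrite -ler_pdivlMr//; lra.
  by rewrite mulrDr mulr1 mulrC; lra.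
have := HC t N (ltW t0); set S := \sum_(0 <= k < N) t * p (k%:R * t).
have S0 : 0 <= S.
  by apply: sumr_ge0 => k _; rewrite mulr_ge0 ?(ltW t0)//; exact: Rintegral_ge0.
have Sm : S <= m + t.
  have := sum_le_mean_exit_time hX l r x N t0.
  by rewrite Em -EFinD lee_fin.
have kt0 k : 0 <= k%:R * t by rewrite mulr_ge0// ltW.
set Z := \int[P x]_w _ => HZ.
have uext s w : extend0 u (X s w) <= K * extend0 \1_J (X s w).
  case: (X s w) => [q|] /=; last by rewrite mulr0.
  have [Jq|nJq] := pselect (J q); first by rewrite indicE mem_set// mulr1.
  by rewrite indicE memNset// mulr0; exact: uJ.
have Zle : Z <= K * p (N%:R * t) - K + K * \int[P x]_w comeback t N w.
  have start : \int[P x]_w (\1_(B 0) w * extend0 u (X 0 w)) = K.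
    apply: (@expect_ae_cst _ _ _ _ (state_in X 0 [set x])).
    - exact: (diffusion_measurable hX).
    - exact: (diffusion_start hX).
    - by apply: measurable_funM; [exact: (bB 0).1 | exact: (bu (lexx 0)).1].
    move=> w [_ /= -> X0]; rewrite -X0 /= uxK indicE mem_set ?mul1r// => s.
    by rewrite -eq_le => /eqP <-; exists x.
  have bs : bounded_rv (fun w => \1_(B 0) w * extend0 u (X 0 w)).
    by apply: bounded_rvM => //; exact: bu.
  have br := bounded_return N (ltW t0).
  rewrite -[X in _ - X + _]start -!expectZ// -expectB//; last exact: bounded_rvZ.
  rewrite -expectD; [|by apply: bounded_rvB => //; exact: bounded_rvZ|exact: bounded_rvZ].
  apply: expect_le.
  - by apply: bounded_rv_sum => k; apply: bounded_rvM => //;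
      apply: bounded_rvB; exact: bu.
  - by apply: bounded_rvD; [apply: bounded_rvB => //|]; exact: bounded_rvZ.
  move=> w; rewrite (summation_by_parts (fun k => \1_(B (k%:R * t)) w)
    (fun k => extend0 u (X (k%:R * t) w))) mul0r.
  apply: lerD; first apply: lerB => //.
    rewrite [leRHS]mulrC ler_wpM2l// (le_trans (uext _ _))//.
    by rewrite ler_piMr//; case/andP: (ext_J01 (N%:R * t) w).
  rewrite /comeback mulr_sumr; apply: ler_sum => k _.
  rewrite [leRHS]mulrCA; apply: ler_wpM2l; last exact: uext.
  exact: stays_decr (ltW t0).
rewrite NT in Zle.
have h1 : K * p T%:R <= K * y by rewrite ler_wpM2l.
have h2 : K * \int[P x]_w comeback t N w <= K * y by rewrite ler_wpM2l.
have h3 : (e + C * t) * S <= e' * S by rewrite ler_wpM2r.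
have h4 : (e' - c) * S <= (e' - c) * (m + t) by rewrite ler_wpM2l//; lra.
have h5 : (e' - c) * t <= (e' - c) * y by rewrite ler_wpM2l//; lra.
have h6 : D * y = z by rewrite /y mulrC divfK ?gt_eqF.
move: HZ; rewrite ler_norml => /andP[HZ _].
rewrite /D in h6; lra.
Unshelve. all: by end_near. Qed.

End bounds.

(** * The parabola as test function *)

Section parabola.
Context (d : measure_display) (Omega : measurableType d) (R : realType).
Context (I : set R) (P : R -> probability Omega R).
Context (X : R -> Omega -> option R) (a b : R -> R).
Context (hX : regular_diffusion I P X) (hG : associated_operator I P X a b).
Variables (x r A e e' h : R).
Hypotheses (h0 : 0 < h) (e0 : 0 <= e) (ee' : e < e').
Hypothesis near_x : forall y, `|y - x| < r ->
  I y /\ `|a y ^+ 2 + 2 * b y * (y - x) - A| <= e.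

(* Two nested cutoffs: p is 1 on a neighbourhood of the support of v, so that the
   truncated parabola has the generator of the parabola where v does not vanish. *)
Let test_function (r2 K : R) : h < r2 -> r2 < r ->
  exists p v : R -> R, let u y := (K - (y - x) * (y - x)) * p y in
  [/\ C2c (interior I) u, C2c (interior I) v, forall z, 0 <= v z <= 1,
      forall z, x - h < z < x + h -> I z /\ v z = 1 &
      forall z, I z -> v z != 0 -> `|diff_op a b u z - (- A)| <= e] /\
  [/\ forall y, 0 <= p y <= 1, p x = 1 & forall y, r2 <= `|y - x| -> p y = 0].
Proof.
move=> hr2 r2r; have hh := h0.
pose r1 := (h + r2) / 2; pose r1' := (h + r1) / 2.
have r1r2 : r1 < r2 by rewrite /r1; lra.
have hr1' : h < r1' by rewrite /r1' /r1; lra.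
have r1'r1 : r1' < r1 by rewrite /r1' /r1; lra.
have [p [p1 [p2 [sp p01 pone pzero]]]] := @smooth_cutoff _ x r1 r2 (ltac:(lra)) r1r2.
have [v [v1 [v2 [sv v01 vone vzero]]]] := @smooth_cutoff _ x h r1' h0 hr1'.
have intI (q : R) : q < r -> forall y, `|y - x| <= q -> interior I y.
  move=> qr y yq; apply/nbhs_ballP; exists (r - `|y - x|) => /=; first by lra.
  move=> z; rewrite /ball /= => yz; apply: (near_x _).1.
  by have := ler_distD y z x; rewrite (distrC z y); lra.
have sx := smooth2B (smooth2_id R) (smooth2_cst x).
have sq := smooth2B (smooth2_cst K) (smooth2M sx sx).
exists p, v => u; split; split.
- apply: (smooth2_C2c (smooth2M sq sp) (x0 := x) (r := r2)); last exact: intI.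
  by move=> y /pzero ->; rewrite mulr0.
- by apply: (smooth2_C2c sv vzero); apply: intI; lra.
- exact: v01.
- move=> z; rewrite -ltr_distl => /ltW zh; split; last exact: vone.
  by apply: (near_x _).1; lra.
- move=> z _ vz; have zr : `|z - x| < r1'.
    by rewrite ltNge; apply/negP => /vzero; apply/eqP.
  rewrite /u (diff_op_parabola a b K sp pone); last by lra.
  by rewrite -opprD normrN; apply: (near_x _).2; lra.
- exact: p01.
- by apply: pone; rewrite subrr normr0; lra.
- exact: pzero.
Qed.

Let lxr : x - h < x < x + h.
Proof. by have := h0 => hh; apply/andP; split; lra. Qed.

(* Truncation at distance r2, where the parabola vanishes, keeps it nonnegative. *)
Lemma parabola_upper (r2 : R) : h < r2 -> r2 < r -> e' < A ->
  (mean_exit_time P X x (x - h) (x + h) <= (r2 ^+ 2 / (A - e'))%:E)%E.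
Proof.
move=> hr2 r2r e'A; have hh := h0.
have [p [v [[Cu Cv v01 v1 uc] [p01 px p0]]]] := test_function (r2 ^+ 2) hr2 r2r.
have := mean_exit_time_upper hX hG lxr Cu Cv e0 v01 v1 uc _ ee' _.
rewrite subrr mulr0 subr0 px mulr1 opprK; apply; last by lra.
move=> y; have [yr|yr] := leP r2 `|y - x|; first by rewrite p0 ?mulr0.
rewrite mulr_ge0 ?subr_ge0//; last by case/andP: (p01 y).
by rewrite -expr2 -real_normK ?num_real// lerXn2r ?nnegrE// ?ltW//; lra.
Qed.

Lemma parabola_lower (k m : R) : 0 < k -> k < h -> h < r -> 0 <= A ->
  mean_exit_time P X x (x - h) (x + h) = m%:E -> k ^+ 2 <= (A + e') * m.
Proof.
move=> k0 kh hr A0 Em; have hh := h0.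
have [p [v [[Cu Cv v01 v1 uc] [p01 px p0]]]] :=
  @test_function ((h + r) / 2) (k ^+ 2) (ltac:(lra)) (ltac:(lra)).
have := mean_exit_time_lower hX hG lxr Cu Cv e0 v01 v1 uc (l' := x - k) (r' := x + k)
   (K := k ^+ 2) _ _ _ _ _ _ ee' _ Em.
rewrite opprK [e' + A]addrC; apply.
- by lra.
- by lra.
- move=> y; have /andP[py0 py1] := p01 y; have q0 := sqr_ge0 (y - x).
  rewrite expr2 in q0; have kk := sqr_ge0 k.
  have [q1|q1] := leP 0 (k ^+ 2 - (y - x) * (y - x)).
    by apply: le_trans (ler_piMr q1 py1) _; lra.
  by apply: le_trans kk; rewrite mulr_le0_ge0// ltW.
- move=> y; rewrite -ltr_distl => /negP; rewrite -leNgt => ky.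
  rewrite mulr_le0_ge0//; last by case/andP: (p01 y).
  by rewrite subr_le0 -expr2 -(real_normK (num_real (y - x))) lerXn2r ?nnegrE// ltW.
- by rewrite subrr mulr0 subr0 px mulr1.
- exact: sqr_ge0.
- by lra.
Qed.

(** The limits [r2 -> h] and [k -> h] in the two preceding bounds. *)
Lemma mean_exit_time_sandwich : h < r -> e' < A ->
  exists2 m, mean_exit_time P X x (x - h) (x + h) = m%:E &
    h ^+ 2 / (A + e') <= m <= h ^+ 2 / (A - e').
Proof.
move=> hr e'A; have hh := h0; have e00 := e0; have ee := ee'.
have fin : mean_exit_time P X x (x - h) (x + h) \is a fin_num.
  rewrite ge0_fin_numE; last by apply: integral_ge0 => w _; exact: exit_time_ge0.
  apply: le_lt_trans (@parabola_upper ((h + r) / 2) _ _ e'A) (ltry _); lra.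
exists (fine (mean_exit_time P X x (x - h) (x + h))); first by rewrite fineK.
set m := fine _; have Em : mean_exit_time P X x (x - h) (x + h) = m%:E by rewrite fineK.
have Ae : 0 < A - e' by lra.
have Ae' : 0 < A + e' by lra.
apply/andP; split.
  rewrite ler_pdivrMr// mulrC; apply/ler_addgt0Pr => z z0.
  pose y := Num.min (h / 2) (z / (2 * h)).
  have y0 : 0 < y by rewrite lt_min !divr_gt0//; lra.
  have yh : y <= h / 2 by rewrite ge_min lexx.
  have yz : y * (2 * h) <= z by rewrite -ler_pdivlMr ?ge_min ?lexx ?orbT//; lra.
  have := @parabola_lower (h - y) m (ltac:(lra)) (ltac:(lra)) hr (ltac:(lra)) Em.
  have := sqr_ge0 y; rewrite !expr2; lra.
rewrite ler_pdivlMr//; apply/ler_addgt0Pr => z z0.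
pose y := Num.min (Num.min ((r - h) / 2) 1) (z / (2 * h + 1)).
have y0 : 0 < y by rewrite !lt_min ltr01 andbT !divr_gt0//; lra.
have yr : y <= (r - h) / 2 by rewrite !ge_min lexx.
have y1 : y <= 1 by rewrite !ge_min lexx orbT.
have yz : y * (2 * h + 1) <= z by rewrite -ler_pdivlMr ?ge_min ?lexx ?orbT//; lra.
have := @parabola_upper (h + y) (ltac:(lra)) (ltac:(lra)) e'A.
rewrite Em lee_fin ler_pdivlMr// => /le_trans; apply.
have : y * y <= y by rewrite ler_piMr// ltW.
rewrite expr2; lra.
Qed.

End parabola.

Lemma drift_near (R : realType) (I : set R) (a b : R -> R) (x e : R) :
  {within I, continuous (fun y => a y ^+ 2)} -> {within I, continuous b} ->
  interior I x -> 0 < e ->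
  exists2 r, 0 < r & forall y, `|y - x| < r ->
    I y /\ `|a y ^+ 2 + 2 * b y * (y - x) - a x ^+ 2| <= e.
Proof.
move=> ca cb Ix e0.
have cint (f : R -> R) : {within I, continuous f} -> {for x, continuous f}.
  move=> /(continuous_subspaceW (@interior_subset _ I)).
  rewrite (continuous_open_subspace _ (@open_interior _ I)); apply.
  by rewrite inE.
pose M := `|b x| + 1; have M0 : 0 < M by rewrite /M ltr_wpDl.
have M4 : 0 < e / (4 * M) by rewrite divr_gt0// mulr_gt0.
have /nbhs_ballP [r r0 Hr] : \forall y \near x, [/\ I y,
    `|a x ^+ 2 - a y ^+ 2| <= e / 2, `|b x - b y| <= 1 & `|x - y| <= e / (4 * M)].
  have HI : \forall y \near x, I y by [].
  have Ha : \forall y \near x, `|a x ^+ 2 - a y ^+ 2| <= e / 2.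
    have /cvgrPdist_le := cint _ ca; apply; exact: divr_gt0.
  have Hb : \forall y \near x, `|b x - b y| <= 1.
    have /cvgrPdist_le := cint _ cb; apply; exact: ltr01.
  have Hx : \forall y \near x, `|x - y| <= e / (4 * M).
    apply/nbhs_ballP; exists (e / (4 * M)) => // y; exact: ltW.
  by near=> y; split; near: y.
exists r => // y yr; have [|Iy Ha Hb Hx] := Hr y.
  by rewrite /ball /= distrC.
split=> //.
have bM : `|b y| <= M.
  by have := ler_distD 0 (b y) (b x); rewrite /M !subr0 -(distrC (b x));
     have := lerB_dist (b y) (b x); rewrite (distrC (b y)); lra.
have : `|2 * b y * (y - x)| <= e / 2.
  rewrite !normrM (ger0_norm (ler0n _ 2)) (distrC y).
  have -> : e / 2 = 2 * M * (e / (4 * M)) by field; rewrite gt_eqF.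
  by apply: ler_pM => //; exact: ler_wpM2l.
have := ler_normD (a y ^+ 2 - a x ^+ 2) (2 * b y * (y - x)).
by rewrite distrC in Ha; rewrite addrAC; lra.
Unshelve. all: by end_near. Qed.

Unset Implicit Arguments.

Theorem proposition2p3 (d : measure_display) (Omega : measurableType d)
    (R : realType) (I : set R) (P : R -> probability Omega R)
    (X : R -> Omega -> option R) (a b : R -> R) (xo : R)
    (hX : regular_diffusion I P X)
    (ha_cont : {within I, continuous (fun x => a x ^+ 2)})
    (ha_pos : forall x, I x -> 0 < a x ^+ 2)
    (hb_cont : {within I, continuous b})
    (hG : associated_operator I P X a b)
    (hxo : interior I xo) :
  (mean_exit_time P X xo (xo - h) (xo + h) / (h ^+ 2)%:E)%E @[h --> 0^'+]
    --> ((a xo ^+ 2)^-1)%:E.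
Proof.
have A0 : 0 < a xo ^+ 2 by apply: ha_pos; exact: (interior_subset hxo).
set A := a xo ^+ 2 in A0 *.
have sandwich e' : 0 < e' -> e' < A -> \forall h \near 0^'+, exists2 m : R,
    (mean_exit_time P X xo (xo - h) (xo + h) / (h ^+ 2)%:E)%E = m%:E &
    (A + e')^-1 <= m <= (A - e')^-1.
  move=> e'0 e'A; have e20 : 0 < e' / 2 by rewrite divr_gt0.
  have [r r0 Hr] := drift_near ha_cont hb_cont hxo e20.
  near=> h; have h0 : 0 < h by near: h; exact: nbhs_right_gt.
  have hr : h < r by near: h; exact: nbhs_right_lt.
  have [m Em /andP[m1 m2]] := @mean_exit_time_sandwich _ _ _ _ _ _ _ _ hX hG xo r A
    (e' / 2) e' h h0 (ltW e20) (ltac:(lra)) Hr hr e'A.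
  have h20 : 0 < h ^+ 2 by rewrite exprn_gt0.
  exists (m / h ^+ 2); first by rewrite Em inver gt_eqF// EFinM.
  by rewrite ler_pdivlMr// ler_pdivrMr// mulrC m1 [_^-1 * _]mulrC.
clearbody A; apply/fine_cvgP; split.
  have := sandwich (A / 2) (ltac:(lra)) (ltac:(lra)).
  by apply: filterS => h [m -> _].
apply/cvgrPdist_le => z z0.
pose e' := Num.min (A / 2) (z * A ^+ 2 / 2).
have A20 : 0 < A ^+ 2 by rewrite exprn_gt0.
have e'0 : 0 < e' by rewrite lt_min !divr_gt0// mulr_gt0.
have e'A : e' <= A / 2 by rewrite ge_min lexx.
have e'z : e' <= z * A ^+ 2 / 2 by rewrite ge_min lexx orbT.
have := sandwich e' e'0 (ltac:(lra)).
apply: filterS => h [m /= -> /andP[m1 m2]] /=.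
(* 1/(A - e') - 1/A and 1/A - 1/(A + e') are at most 2 e' / A^2 *)
have e'A2 : e' * (2 / A ^+ 2) <= z.
  rewrite mulrA ler_pdivrMr//; lra.
have i1 : (A - e')^-1 - A^-1 <= e' * (2 / A ^+ 2).
  have -> : (A - e')^-1 - A^-1 = e' * ((A - e') * A)^-1.
    by field; rewrite !gt_eqF//; lra.
  rewrite ler_wpM2l ?(ltW e'0)//.
  have -> : 2 / A ^+ 2 = (A / 2 * A)^-1 by field; rewrite gt_eqF.
  rewrite lef_pV2 ?posrE ?mulr_gt0//; try lra.
  by rewrite ler_wpM2r ?(ltW A0)//; lra.
have i2 : A^-1 - (A + e')^-1 <= e' * (2 / A ^+ 2).
  have -> : A^-1 - (A + e')^-1 = e' * ((A + e') * A)^-1.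
    by field; rewrite !gt_eqF//; lra.
  rewrite ler_wpM2l ?(ltW e'0)//.
  have -> : 2 / A ^+ 2 = (A / 2 * A)^-1 by field; rewrite gt_eqF.
  rewrite lef_pV2 ?posrE ?mulr_gt0//; try lra.
  by rewrite ler_wpM2r ?(ltW A0)//; lra.
rewrite ler_norml; apply/andP; split; lra.
Unshelve. all: by end_near. Qed.
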